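(* Set $n=2m+\epsilon$, where $\epsilon\in\{0,1\}$ and $n\ge3$. Let $\sigma_{ab}$ be a generic conformal Killing–Yano $2$-form on some open subset $\mathcal{U}$ of $\mathcal{Q}^n$, with associated tractor $3$-form $\Sigma_{\mathcal{A}\mathcal{B}\mathcal{C}}$. Then if the almost null structure associated to some eigenspinor of $\sigma_{ab}$ is integrable and co-integrable, it must arise from the submanifold in $\widehat{\mathcal{U}}\subset\mathbb{PT}$ defined by $$\Sigma^{\mathcal{A}\mathcal{B}\mathcal{C}}\,\Gamma^{(m+1+\epsilon)}_{\mathcal{A}\mathcal{B}\mathcal{C}\mathcal{D}_4\ldots\mathcal{D}_{m+1+\epsilon}\,\boldsymbol{\alpha}\boldsymbol{\beta}}\,Z^{\boldsymbol{\alpha}}Z^{\boldsymbol{\beta}}=0 .$$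
   Context: Everything is holomorphic. $\mathbb{V}\cong\mathbb{C}^{n+2}$ is oriented with a non-degenerate symmetric bilinear form $h_{\mathcal{A}\mathcal{B}}$. If $n=2m+1$, $\mathbb{S}$ is the $2^{m+1}$-dimensional spinor representation of $\mathrm{Spin}(n+2,\mathbb{C})$; if $n=2m$, $\mathbb{S}$ and $\mathbb{S}'$ are the two $2^m$-dimensional chiral spinor representations. The Clifford generators $\Gamma_{\mathcal{A}}$ satisfy $\Gamma_{(\mathcal{A}}\Gamma_{\mathcal{B})}=-h_{\mathcal{A}\mathcal{B}}\mathrm{Id}$, and $\Gamma^{(k)}_{\mathcal{A}_1\dots\mathcal{A}_k\,\boldsymbol{\alpha}\boldsymbol{\beta}}$ is the $\wedge^k\mathbb{V}^*$-valued bilinear form on $\mathbb{S}$ obtained by pairing, with the spin-invariant bilinear form, the skew-symmetrised product of $k$ Clifford generators applied to the first argument with the second argument; $\gamma^{(k)}$ denotes the analogous forms for the spinors of the tangent spaces of $\mathcal{Q}^n$ (Clifford generators $\gamma_a$). $\mathcal{Q}^n=\{[X]\in\mathbb{P}\mathbb{V}:h(X,X)=0\}$ with its natural conformal structure. For $n=2m+1$, $\mathbb{PT}$ is the space of $\gamma$-planes ($m$-dimensional linear subspaces of $\mathcal{Q}^n$); for $n=2m$, $\mathbb{PT}$ is the space of $\alpha$-planes (self-dual $m$-dimensional linear subspaces). In both cases $\mathbb{PT}$ is identified with the projective pure spinors $[Z^{\boldsymbol{\alpha}}]\in\mathbb{P}\mathbb{S}$ (spinors whose annihilator in $\mathbb{V}$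 has dimension $m+1$), with $\check{Z}\subset\mathcal{Q}^n$ the projectivised annihilator. For $x\in\mathcal{Q}^n$, $\hat{x}=\{Z\in\mathbb{PT}:x\in\check{Z}\}$ and $\widehat{\mathcal{U}}=\bigcup_{x\in\mathcal{U}}\hat{x}$. A conformal Killing–Yano (CKY) $2$-form is a $2$-form $\sigma_{ab}$ (of conformal weight $3$) with $\nabla_a\sigma_{bc}=\mu_{abc}+2g_{a[b}\varphi_{c]}$, where $\mu_{abc}=\nabla_{[a}\sigma_{bc]}$ and $\varphi_a=\frac1{n-2}\nabla^b\sigma_{ba}$; the equation is conformally invariant and equivalent to the existence of a constant (parallel) tractor $3$-form $\Sigma_{\mathcal{A}\mathcal{B}\mathcal{C}}\in\wedge^3\mathbb{V}^*$ with components $(\sigma_{ab},\mu_{abc},\varphi_a,\rho_{ab})$. Explicitly, in the chart $\mathbb{C}\mathbb{E}^n$ with flat metric $g_{ab}$ and coordinates $x^a$, embedded by $X^{\mathcal{A}}=\mathring{X}^{\mathcal{A}}+x^a\mathring{Z}_a^{\mathcal{A}}-\frac12(x^ax_a)\mathring{Y}^{\mathcal{A}}$ (where $\mathring{X},\mathring{Y}$ are null with $h(\mathring{X},\mathring{Y})=1$, and $\mathring{Z}_a$ span $\langle\mathring{X},\mathring{Y}\rangle^\perp$ with $h(\mathring{Z}_a,\mathring{Z}_b)=g_{ab}$), set $Z_a^{\mathcal{A}}=\mathring{Z}_a^{\mathcal{A}}-x_a\mathring{Y}^{\mathcal{A}}$, $Y^{\mathcal{A}}=\mathring{Y}^{\mathcal{A}}$,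 $\rho_{ab}=\nabla_a\varphi_b$; then $$\Sigma_{\mathcal{A}\mathcal{B}\mathcal{C}}=3Y_{[\mathcal{A}}Z^b_{\mathcal{B}}Z^c_{\mathcal{C}]}\sigma_{bc}+Z^a_{\mathcal{A}}Z^b_{\mathcal{B}}Z^c_{\mathcal{C}}\mu_{abc}+6X_{[\mathcal{A}}Y_{\mathcal{B}}Z^c_{\mathcal{C}]}\varphi_c+3X_{[\mathcal{A}}Z^b_{\mathcal{B}}Z^c_{\mathcal{C}]}\rho_{bc}.$$ Generic: $\sigma_a{}^b$, as an endomorphism of the tangent bundle, has $m$ distinct pairs $(\lambda,-\lambda)$ of non-zero eigenvalues (and in addition a zero eigenvalue when $n=2m+1$), and $\sigma_{ab}$, as an element of the Clifford algebra, has $2^m$ distinct eigenvalues, with all its eigenspinors pure (for $n=2m$, $2^{m-1}$ eigenspaces in each chirality). An eigenspinor of $\sigma_{ab}$ is a spinor field $\xi$ with $\sigma^{ab}\gamma_a\gamma_b\,\xi=\lambda\xi$ for some function $\lambda$; for pure $\xi$ this is equivalent to $\sigma^{ab}\gamma^{(m+\epsilon)}_{abc_3\ldots c_{m+\epsilon}}(\xi,\xi)=0$. For $n=2m$ one considers eigenspinors $\xi$ of the chirality corresponding to $\alpha$-planes (primed spinors $\xi^{\mathbf{A}'}$). The associated almost null structure is the totally null rank-$m$ distribution $N_x=\{v\in\mathrm{T}_x\mathcal{Q}^n:v^a\gamma_a\xi=0\}$; it is integrable (respectively co-integrable) if $N$ (respectively $N^\perp$) is closed under Lie bracket of local sections (for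 $n=2m$, $N^\perp=N$). ''$N$ arises from $\mathcal{W}\subset\mathbb{PT}$'' means: for $x\in\mathcal{U}$, $N_x=\mathrm{T}_x\check{Z}_x$ for a twistor $Z_x\in\mathcal{W}\cap\hat{x}$ depending holomorphically on $x$ (locally). *)

(* Defs.v *)
(* The complex numbers are R[i] for R : realType; [differentiable] and ['D_v f]
   over the field R[i] are complex differentiability and complex directional
   derivatives. *)
From HB Require Import structures.
From mathcomp Require Import all_boot all_order all_algebra all_fingroup.
From mathcomp Require Import complex.
From mathcomp Require Import all_classical all_reals all_analysis.

Set Implicit Arguments.
Unset Strict Implicit.
Unset Printing Implicit Defensive.

Import Order.TTheory GRing.Theory Num.Theory numFieldNormedType.Exports.
Local Open Scope classical_set_scope.
Local Open Scope ring_scope.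

(* The topology of the normed space C^k. *)
Definition copen (R : realType) (k : nat) (O : set 'rV[R[i]]_k) : Prop :=
  open (O : set ('rV[R[i]]_k : normedModType R[i])).

Definition holo_at (R : realType) (k : nat) (W : normedModType R[i])
    (f : 'rV[R[i]]_k -> W) (x : 'rV[R[i]]_k) : Prop :=
  differentiable f (x : ('rV[R[i]]_k : normedModType R[i])).

Section Quadric.
Variables (R : realType) (n : nat).
Local Notation C := R[i].
Local Notation V := 'rV[C]_n.+2.
Variable h : 'M[C]_n.+2.

Definition hform (u v : V) : C := (u *m h *m v^T) 0 0.

(* Subsets of the projective quadric are represented by the corresponding
   conical subsets of the punctured null cone. *)
Definition cone : set V := [set X | X != 0 /\ hform X X = 0].

Definition open_in_quadric (U : set V) : Prop :=
  [/\ U `<=` cone,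
      (forall (s : C) X, s != 0 -> U X -> U (s *: X)) &
      exists2 O : set V, copen O & U = O `&` cone].

(* X, Y and the rows Z_a of Z; each adapted frame determines an affine chart
   of the quadric, and these charts cover it. *)
Record frame := Frame { frX : V; frY : V; frZ : 'M[C]_(n, n.+2) }.

Definition adapted (F : frame) : Prop :=
  [/\ hform (frX F) (frX F) = 0, hform (frY F) (frY F) = 0,
      hform (frX F) (frY F) = 1,
      (forall a, hform (frX F) (row a (frZ F)) = 0 /\
                 hform (frY F) (row a (frZ F)) = 0) &
      row_free (frZ F)].

Definition metric (F : frame) : 'M[C]_n := frZ F *m h *m (frZ F)^T.

Definition emb (F : frame) (x : 'rV[C]_n) : V :=
  frX F + x *m frZ F - (2^-1 * (x *m metric F *m x^T) 0 0) *: frY F.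

(* The row a is Z_a - x_a Y, which is also the derivative of emb along x^a. *)
Definition Zslot (F : frame) (x : 'rV[C]_n) : 'M[C]_(n, n.+2) :=
  frZ F - (x *m metric F)^T *m frY F.

Definition chart_dom (U : set V) (F : frame) : set 'rV[C]_n :=
  [set x | U (emb F x)].

Definition pd (a : 'I_n) (f : 'rV[C]_n -> C^o) (x : 'rV[C]_n) : C :=
  'D_(delta_mx 0 a) f x.

Definition alt3 (k : nat) (T : 'I_k -> 'I_k -> 'I_k -> C) (a b c : 'I_k) : C :=
  6^-1 * (T a b c + T b c a + T c a b - T b a c - T a c b - T c b a).

Definition weighted_form (sig : V -> 'M[C]_n.+2) (X v w : V) : C :=
  (v *m sig X *m w^T) 0 0.

Definition sigma_chart (sig : V -> 'M[C]_n.+2) (F : frame) (x : 'rV[C]_n) :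
    'M[C]_n :=
  Zslot F x *m sig (emb F x) *m (Zslot F x)^T.

(* The tangent space of the quadric at [X] is X^\perp / X, and rescaling X by s
   rescales tangent vectors of the cone by s.  So a 2-form of conformal weight
   3 is a family of skew forms sigma_X on X^\perp / X, with
   sigma_{sX}(sv, sw) = s^3 sigma_X(v, w).  The matrix sig X only matters
   through its restriction to X^\perp. *)
Definition holo_two_form_weight3 (U : set V) (sig : V -> 'M[C]_n.+2) : Prop :=
  [/\ (forall X v w, U X -> hform X v = 0 -> hform X w = 0 ->
         weighted_form sig X v w = - weighted_form sig X w v),
      (forall X w, U X -> hform X w = 0 -> weighted_form sig X X w = 0),
      (forall (s : C) X v w, s != 0 -> U X -> hform X v = 0 -> hform X w = 0 ->
         weighted_form sig (s *: X) (s *: v) (s *: w)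
         = s ^+ 3 * weighted_form sig X v w) &
      (forall F, adapted F -> forall x, chart_dom U F x -> forall a b,
         holo_at (fun y => sigma_chart sig F y a b : C^o) x)].

Section ConformalKillingYano.
Variables (sig : V -> 'M[C]_n.+2) (F : frame).
Local Notation g := (metric F).
Local Notation gi := (invmx (metric F)).

Definition dsigma (x : 'rV[C]_n) (a b c : 'I_n) : C :=
  pd a (fun y => sigma_chart sig F y b c) x.

Definition mu (x : 'rV[C]_n) (a b c : 'I_n) : C := alt3 (dsigma x) a b c.

(* The factor (n - 1)^-1 is the one forced by tracing the equation
   nabla_a sigma_bc = mu_abc + g_ab phi_c - g_ac phi_b over a, b. *)
Definition phi (x : 'rV[C]_n) (a : 'I_n) : C :=
  (n%:R - 1)^-1 * \sum_b \sum_c gi b c * dsigma x c b a.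

Definition rho (x : 'rV[C]_n) (a b : 'I_n) : C := pd a (fun y => phi y b) x.

Definition cky_at (x : 'rV[C]_n) : Prop := forall a b c,
  dsigma x a b c = mu x a b c + (g a b * phi x c - g a c * phi x b).

(* X_A, Y_A, and Z^b_A with the tangent index raised by g. *)
Definition Xlow (x : 'rV[C]_n) (A : 'I_n.+2) : C := (emb F x *m h) 0 A.
Definition Ylow (A : 'I_n.+2) : C := (frY F *m h) 0 A.
Definition Zlow (x : 'rV[C]_n) (b : 'I_n) (A : 'I_n.+2) : C :=
  (gi *m Zslot F x *m h) b A.

Definition tractor3 (x : 'rV[C]_n) (A B D : 'I_n.+2) : C :=
  3 * alt3 (fun A B D => \sum_b \sum_c
        Ylow A * Zlow x b B * Zlow x c D * sigma_chart sig F x b c) A B D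
  + \sum_a \sum_b \sum_c Zlow x a A * Zlow x b B * Zlow x c D * mu x a b c
  + 6 * alt3 (fun A B D => \sum_c Xlow x A * Ylow B * Zlow x c D * phi x c) A B D
  + 3 * alt3 (fun A B D => \sum_b \sum_c
        Xlow x A * Zlow x b B * Zlow x c D * rho x b c) A B D.

End ConformalKillingYano.

Definition cky (U : set V) (sig : V -> 'M[C]_n.+2) : Prop :=
  holo_two_form_weight3 U sig /\
  forall F, adapted F -> forall x, chart_dom U F x -> cky_at sig F x.

Definition associated_tractor (U : set V) (sig : V -> 'M[C]_n.+2)
    (Sigma : 'I_n.+2 -> 'I_n.+2 -> 'I_n.+2 -> C) : Prop :=
  (forall A B D, Sigma A B D = - Sigma B A D /\ Sigma A B D = - Sigma A D B) /\
  forall F, adapted F -> forall x, chart_dom U F x ->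
    forall A B D, Sigma A B D = tractor3 sig F x A B D.

Definition raise3 (Sigma : 'I_n.+2 -> 'I_n.+2 -> 'I_n.+2 -> C)
    (A B D : 'I_n.+2) : C :=
  \sum_A' \sum_B' \sum_D'
    invmx h A A' * invmx h B B' * invmx h D D' * Sigma A' B' D'.

Definition orthogonal (g : 'M[C]_n) (D : set 'rV[C]_n) : set 'rV[C]_n :=
  [set w | forall v, D v -> (v *m g *m w^T) 0 0 = 0].

Definition lie_bracket (u v : 'rV[C]_n -> 'rV[C]_n) (x : 'rV[C]_n) : 'rV[C]_n :=
  'D_(u x) v x - 'D_(v x) u x.

Definition involutive (O : set 'rV[C]_n) (D : 'rV[C]_n -> set 'rV[C]_n) : Prop :=
  forall (O' : set 'rV[C]_n) (u v : 'rV[C]_n -> 'rV[C]_n),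
    copen O' -> O' `<=` O ->
    (forall x, O' x -> [/\ holo_at u x, holo_at v x,
                           D x (u x) & D x (v x)]) ->
    forall x, O' x -> D x (lie_bracket u v x).

Section Spinors.
(* For n = 2m + 1 the module C^N is S; for n = 2m it is the sum of S and S'. *)
Variables (m : nat).
Local Notation N := (2 ^ m.+1)%N.
Local Notation spinor := 'cV[C]_N.
Variable Gam : 'I_n.+2 -> 'M[C]_N.

(* A Clifford module of dimension 2^(m+1) over V is irreducible, so these
   relations characterise the spin module. *)
Definition clifford_module : Prop := forall A B,
  2^-1 *: (Gam A *m Gam B + Gam B *m Gam A) = (- h A B)%:M.

Definition slash (v : V) : 'M[C]_N := \sum_A v 0 A *: Gam A.

(* For n = 2m there are exactly two such chi, opposite to each other; choosing
   one is choosing an orientation of V, S being its eigenspace for 1. *)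
Definition chirality (chi : 'M[C]_N) : Prop :=
  chi *m chi = 1%:M /\ forall A, chi *m Gam A = - (Gam A *m chi).

Definition inS (eps : bool) (chi : 'M[C]_N) (Z : spinor) : Prop :=
  ~~ eps -> chi *m Z = Z.

(* Spin(V) is generated by the products of two unit vectors. *)
Definition spin_invariant_pairing (B : 'M[C]_N) : Prop :=
  B \in unitmx /\
  forall u v : V, hform u u = 1 -> hform v v = 1 ->
    (slash u *m slash v)^T *m B *m (slash u *m slash v) = B.

(* The skew-symmetrised product Gamma_[A_1 ... A_k] for s = [:: A_1; ...; A_k] *)
Definition gamma_skew (s : seq 'I_n.+2) : 'M[C]_N :=
  ((size s)`!%:R)^-1 *:
  \sum_(p : 'S_(size s)) (-1) ^+ p *:
     \big[mulmx/1%:M]_(i < size s) Gam (tnth (in_tuple s) (p i)).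

Definition gamma_form (B : 'M[C]_N) (s : seq 'I_n.+2) (Z W : spinor) : C :=
  ((gamma_skew s *m Z)^T *m B *m W) 0 0.

(* Row kernels of these matrices are the annihilators of a spinor in V, and,
   at the point x of a chart, in the tangent space (with gamma_a the Clifford
   action of Z_a). *)
Definition ann_mx (Z : spinor) : 'M[C]_n.+2 :=
  kermx (\matrix_(A < n.+2) (Gam A *m Z)^T).

Definition gamma_tan (F : frame) (x : 'rV[C]_n) (a : 'I_n) : 'M[C]_N :=
  slash (row a (Zslot F x)).

Definition tan_ann_mx (F : frame) (x : 'rV[C]_n) (xi : spinor) : 'M[C]_n :=
  kermx (\matrix_(a < n) (gamma_tan F x a *m xi)^T).

Definition twistor (eps : bool) (chi : 'M[C]_N) (Z : spinor) : Prop :=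
  [/\ Z != 0, inS eps chi Z & \rank (ann_mx Z) = m.+1].

(* The cone over the linear subspace of the quadric defined by a twistor. *)
Definition zcheck (Z : spinor) : set V := [set X | cone X /\ slash X *m Z = 0].

Definition tangent_zcheck (F : frame) (Z : spinor) (x : 'rV[C]_n) :
    set 'rV[C]_n :=
  [set v | exists c : C^o -> 'rV[C]_n,
     [/\ c 0 = x, is_derive (0 : C^o) (1 : C^o) c v &
         \forall t \near (0 : C^o),
           derivable c t 1 /\ zcheck Z (emb F (c t))]].

(* Spinors of the tangent space at [X].  For v in X^\perp, slash v preserves
   the kernel of slash X, and slash X acts on it by zero; this makes that
   2^m-dimensional kernel a Clifford module over X^\perp / X, namely the fibre
   of the spinor bundle of the quadric (up to conformal weight), embedded in
   the spinor module of V.  For n = 2m its intersection with S consists of the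
   spinors whose chirality corresponds to the planes parametrised by S. *)
Definition tan_spinor (X : V) (xi : spinor) : Prop := slash X *m xi = 0.

(* A nowhere vanishing holomorphic spinor field of conformal weight w. *)
Definition spinor_field (U : set V) (w : int) (xi : V -> spinor) : Prop :=
  [/\ (forall X, U X -> tan_spinor X (xi X) /\ xi X != 0),
      (forall (s : C) X, s != 0 -> U X -> xi (s *: X) = (s ^ w) *: xi X) &
      (forall F, adapted F -> forall x, chart_dom U F x -> forall i,
         holo_at (fun y => xi (emb F y) i 0 : C^o) x)].

Section Eigenspinors.
Variable sig : V -> 'M[C]_n.+2.

Definition sigma_clifford (F : frame) (x : 'rV[C]_n) : 'M[C]_N :=
  \sum_a \sum_b
    (invmx (metric F) *m sigma_chart sig F x *m invmx (metric F)) a b *: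
      (gamma_tan F x a *m gamma_tan F x b).

Definition eigenspinor_at (F : frame) (x : 'rV[C]_n) (lam : C) (xi : spinor) :
    Prop :=
  [/\ tan_spinor (emb F x) xi, xi != 0 & sigma_clifford F x *m xi = lam *: xi].

Definition distinct_eigenvalues (F : frame) (x : 'rV[C]_n) (P : spinor -> Prop)
    (k : nat) : Prop :=
  exists kap : 'I_k -> C, injective kap /\
    forall j, exists2 xi, P xi & eigenspinor_at F x (kap j) xi.

(* sigma_a^b *)
Definition sigma_endo (F : frame) (x : 'rV[C]_n) : 'M[C]_n :=
  sigma_chart sig F x *m invmx (metric F).

Definition generic_at (eps : bool) (chi : 'M[C]_N) (F : frame) (x : 'rV[C]_n) :
    Prop :=
  [/\ (exists lam : 'I_m -> C,
         (forall i, [/\ lam i != 0, eigenvalue (sigma_endo F x) (lam i) &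
                        eigenvalue (sigma_endo F x) (- lam i)]) /\
         (forall i j, i != j -> lam i != lam j /\ lam i != - lam j)),
      (eps -> eigenvalue (sigma_endo F x) 0),
      distinct_eigenvalues F x (fun _ => True) (2 ^ m),
      (~~ eps ->
         distinct_eigenvalues F x (fun xi => chi *m xi = xi) (2 ^ m.-1) /\
         distinct_eigenvalues F x (fun xi => chi *m xi = - xi) (2 ^ m.-1)) &
      (forall lam xi, eigenspinor_at F x lam xi ->
         \rank (tan_ann_mx F x xi) = m)].

Definition generic (U : set V) (eps : bool) (chi : 'M[C]_N) : Prop :=
  forall F, adapted F -> forall x, chart_dom U F x -> generic_at eps chi F x.

Definition eigenspinor_field (U : set V) (eps : bool) (chi : 'M[C]_N)
    (xi : V -> spinor) : Prop :=
  [/\ (exists w, spinor_field U w xi),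
      (forall X, U X -> inS eps chi (xi X)) &
      (forall F, adapted F -> forall x, chart_dom U F x ->
         exists lam, eigenspinor_at F x lam (xi (emb F x)))].

End Eigenspinors.

Definition null_dist (xi : V -> spinor) (F : frame) (x : 'rV[C]_n) :
    set 'rV[C]_n :=
  [set v | (\sum_a v 0 a *: gamma_tan F x a) *m xi (emb F x) = 0].

Definition integrable_null (U : set V) (xi : V -> spinor) : Prop :=
  forall F, adapted F -> involutive (chart_dom U F) (null_dist xi F).

Definition cointegrable_null (U : set V) (xi : V -> spinor) : Prop :=
  forall F, adapted F -> involutive (chart_dom U F)
    (fun x => orthogonal (metric F) (null_dist xi F x)).

(* D_4 ... D_(m+1+eps) are the entries of s. *)
Definition tractor_submanifold (eps : bool) (chi B : 'M[C]_N) (U : set V)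
    (Sigma : 'I_n.+2 -> 'I_n.+2 -> 'I_n.+2 -> C) : set spinor :=
  [set Z | [/\ twistor eps chi Z, (exists2 X, U X & zcheck Z X) &
     forall s : seq 'I_n.+2, (3 + size s = m + 1 + eps)%N ->
       \sum_A \sum_A' \sum_A''
         raise3 Sigma A A' A'' * gamma_form B [:: A, A', A'' & s] Z Z = 0]].

Definition arises_from (U : set V) (xi : V -> spinor) (W : set spinor) : Prop :=
  forall F, adapted F -> forall x0, chart_dom U F x0 ->
    exists (O : set 'rV[C]_n) (Zx : 'rV[C]_n -> spinor),
      [/\ copen O, O x0, O `<=` chart_dom U F,
          (forall x, O x -> holo_at Zx x) &
          forall x, O x -> [/\ W (Zx x), zcheck (Zx x) (emb F x) &
            null_dist xi F x = tangent_zcheck F (Zx x) x]].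

End Spinors.
End Quadric.

(* Main.v *)
Require Import Defs.
From HB Require Import structures.
From mathcomp Require Import all_boot all_order all_algebra all_fingroup.
From mathcomp Require Import complex.
From mathcomp Require Import all_classical all_reals all_analysis.
From mathcomp Require Import ring.
Import Order.TTheory GRing.Theory Num.Theory numFieldNormedType.Exports.
Local Open Scope classical_set_scope.
Local Open Scope ring_scope.

Set Implicit Arguments.
Unset Strict Implicit.
Unset Printing Implicit Defensive.

(** A spinor of the tangent space at [X] is a spinor of V killed by X, so the
    eigenspinor xi(X) is itself a candidate for the twistor Z_x.  It is pure: its
    annihilator W in V is spanned by X and the lift of N_x, of dimension m + 1.
    The space of tangent vectors to the linear subspace of Z_x at x is N_x, because
    N_x is totally null and the chart maps the affine subspace x + N_x into that
    linear subspace ([zcheck_line], [zcheck_tangent]).  What has to be shown is that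
    Z_x satisfies the equation of the submanifold.

    If w kills Z, then the alternating form Gamma(Z, Z) of degree at least 3
    vanishes when w is inserted in a slot ([gamma_form_ann]).  Indices raised, the
    form is therefore a tensor over the orthogonal W^perp, and the equation holds as
    soon as Sigma vanishes on W^perp ([raised_contraction]).  Now W^perp is spanned
    by X and the lift of N^perp ([ann_perp_expand]), and on such vectors Sigma only
    involves the restrictions of sigma and mu to N^perp ([trilin_tractor3]).

    The restriction of sigma to N^perp is zero by algebra ([sigma_perp]): the
    commutator of sigma^ab gamma_a gamma_b with a vector v is the vector sigma v up
    to a factor, so applying it to the eigenspinor shows that N is stable under
    sigma; hence sigma(N, N^perp) = 0, and N^perp / N has dimension eps <= 1.

    The restriction of mu to N^perp is zero by co-integrability ([mu_perp]): mu is
    the exterior derivative of sigma up to a factor, and differentiating the identity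
    sigma(u, v) = 0 for sections u, v of N^perp expresses d sigma on N^perp through
    the values of sigma on Lie brackets of sections, which are again in N^perp. *)

(** * Linear algebra *)

Section LinearAlgebra.
Variable F : fieldType.

(** A column killed by the left kernel of M is a combination of the columns of M:
    the double annihilator of the column space is the column space. *)
Lemma ker_col_factor p q r (M : 'M[F]_(p, q)) (c : 'M[F]_(p, r)) :
  kermx M *m c = 0 -> exists d, c = M *m d.
Proof.
move=> Kc.
have rk : (\rank (col_mx M^T c^T) <= \rank M^T)%N.
  rewrite -tr_row_mx !mxrank_tr.
  have := mxrank_ker M; have := mxrank_ker (row_mx M c).
  have : (\rank (kermx M) <= \rank (kermx (row_mx M c)))%N.
    apply: mxrankS; apply/sub_kermxP.
    by rewrite mul_mx_row Kc mulmx_ker row_mx0.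
  have := rank_leq_row M; have := rank_leq_row (row_mx M c).
  move=> ? ? le1 e1 e2; move: le1; rewrite e1 e2.
  by rewrite leq_sub2lE.
have sub : (M^T <= col_mx M^T c^T)%MS by rewrite -addsmxE addsmxSl.
have : (col_mx M^T c^T <= M^T)%MS by rewrite -(geq_leqif (mxrank_leqif_sup sub)).
rewrite col_mx_sub => /andP[_ /submxP[D eD]].
by exists D^T; rewrite -[c]trmxK eD trmx_mul trmxK.
Qed.

(** If each slot of the tensor G lies in the subspace D, so does G as a whole, and
    its contraction only sees the restriction of the trilinear form T to D. *)
Lemma trilinear_contraction k r (D : 'M[F]_(r, k))
    (T G : 'I_k -> 'I_k -> 'I_k -> F) :
  (forall u v w : 'rV_k, (u <= D)%MS -> (v <= D)%MS -> (w <= D)%MS ->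
     \sum_a \sum_b \sum_c u 0 a * v 0 b * w 0 c * T a b c = 0) ->
  (forall b c, (\row_a G a b c <= D)%MS) ->
  (forall a c, (\row_b G a b c <= D)%MS) ->
  (forall a b, (\row_c G a b c <= D)%MS) ->
  \sum_a \sum_b \sum_c G a b c * T a b c = 0.
Proof.
move=> TD G1 G2 G3.
(* P is the identity on D and its rows lie in D. *)
pose P := pinvmx D *m D.
have PE (v : 'rV[F]_k) : (v <= D)%MS -> forall b, v 0 b = \sum_a v 0 a * P a b.
  by move=> vD b; rewrite -{1}(mulmxKpV vD) -mulmxA !mxE.
have GE a b c : G a b c = \sum_x \sum_y \sum_z G x y z * (P x a * P y b * P z c).
  have := PE _ (G1 b c) a; rewrite mxE => ->; apply: eq_bigr => x _.
  rewrite mxE; have := PE _ (G2 x c) b; rewrite mxE => ->; rewrite mulr_suml.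
  apply: eq_bigr => y _.
  rewrite mxE; have := PE _ (G3 x y) c; rewrite mxE => ->; rewrite !mulr_suml.
  by apply: eq_bigr => z _; rewrite mxE; ring.
transitivity (\sum_x \sum_y \sum_z G x y z *
    (\sum_a \sum_b \sum_c P x a * P y b * P z c * T a b c)).
  transitivity (\sum_a \sum_b \sum_c \sum_x \sum_y \sum_z
      G x y z * (P x a * P y b * P z c * T a b c)).
    do 3![apply: eq_bigr => ? _]; rewrite GE mulr_suml.
    do 2![apply: eq_bigr => ? _; rewrite mulr_suml].
    by apply: eq_bigr => ? _; ring.
  under eq_bigr do under eq_bigr do rewrite exchange_big /=.
  under eq_bigr do rewrite exchange_big /=.
  rewrite exchange_big; apply: eq_bigr => x _.
  under eq_bigr do under eq_bigr do rewrite exchange_big /=.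
  under eq_bigr do rewrite exchange_big /=.
  rewrite exchange_big; apply: eq_bigr => y _.
  under eq_bigr do under eq_bigr do rewrite exchange_big /=.
  under eq_bigr do rewrite exchange_big /=.
  rewrite exchange_big; apply: eq_bigr => z _.
  by rewrite mulr_sumr; do 2![apply: eq_bigr => ? _; rewrite mulr_sumr].
have rP x : (row x P <= D)%MS.
  by apply: (submx_trans (row_sub _ _)); rewrite submxMl.
apply: big1 => x _; apply: big1 => y _; apply: big1 => z _.
rewrite [X in _ * X](_ : _ = 0) ?mulr0 //.
apply: etrans (TD _ _ _ (rP x) (rP y) (rP z)).
by do 3![apply: eq_bigr => ? _]; rewrite !mxE.
Qed.

Lemma ker_action p q (A : 'I_p -> 'M[F]_q) (Z : 'cV[F]_q) (v : 'rV[F]_p) :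
  (v <= kermx (\matrix_a (A a *m Z)^T))%MS <-> (\sum_a v 0 a *: A a) *m Z = 0.
Proof.
have E : v *m (\matrix_a (A a *m Z)^T) = ((\sum_a v 0 a *: A a) *m Z)^T.
  rewrite mulmx_sum_row mulmx_suml linear_sum /=; apply: eq_bigr => a _.
  by rewrite rowK -scalemxAl linearZ.
split=> [/sub_kermxP|e]; last by apply/sub_kermxP; rewrite E e trmx0.
by rewrite E => /(congr1 trmx); rewrite trmxK trmx0.
Qed.

(** The rows u with u g y^T = 0 for every y in the row space of W: the orthogonal
    of W for the bilinear form g. *)
Lemma sub_orthP p r (g : 'M[F]_p) (W : 'M[F]_(r, p)) (u : 'rV[F]_p) :
  (u <= kermx (g *m W^T))%MS <->
  (forall y : 'rV[F]_p, (y <= W)%MS -> (u *m g *m y^T) 0 0 = 0).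
Proof.
split=> [/sub_kermxP e y /submxP[d ->]|H].
  by rewrite trmx_mul !mulmxA -(mulmxA u) e mul0mx mxE.
apply/sub_kermxP/rowP => j; rewrite mulmxA.
rewrite [RHS]mxE -(H (row j W) (row_sub _ _)) tr_row.
by rewrite colE mulmxA -colE [RHS]mxE.
Qed.

Lemma orth_sub_orth p r (g : 'M[F]_p) (W : 'M[F]_(r, p)) : g^T = g ->
  (forall y z : 'rV[F]_p, (y <= W)%MS -> (z <= W)%MS -> (y *m g *m z^T) 0 0 = 0) ->
  (W <= kermx (g *m W^T))%MS.
Proof.
move=> gs H; apply/row_subP => i; apply/sub_orthP => y yW.
by apply: H => //; apply: row_sub.
Qed.

Lemma rank_orth p r (g : 'M[F]_p) (W : 'M[F]_(r, p)) : g \in unitmx ->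
  \rank (kermx (g *m W^T)) = (p - \rank W)%N.
Proof. by move=> gu; rewrite mxrank_ker eqmxMfull ?row_full_unit // mxrank_tr. Qed.

Lemma isotropic_rank p r (g : 'M[F]_p) (W : 'M[F]_(r, p)) : g^T = g -> g \in unitmx ->
  (forall y z : 'rV[F]_p, (y <= W)%MS -> (z <= W)%MS -> (y *m g *m z^T) 0 0 = 0) ->
  ((\rank W).*2 <= p)%N.
Proof.
move=> gs gu /(orth_sub_orth gs) /mxrankS; rewrite (rank_orth _ gu).
by rewrite leq_subRL ?rank_leq_col // addnn.
Qed.

Lemma skew_quadratic_comm (W : lmodType F) n (q : 'rV[F]_n)
    (G : 'I_n -> W) (s : 'M[F]_n) : s^T = - s ->
  \sum_a \sum_b s a b *: (2 * q 0 a *: G b - 2 * q 0 b *: G a) =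
  4 *: \sum_b (q *m s) 0 b *: G b.
Proof.
move=> sskew.
have qs b : (q *m s) 0 b = \sum_a s a b * q 0 a.
  by rewrite mxE; apply: eq_bigr => a _; rewrite mulrC.
have e1 : \sum_a \sum_b (s a b * q 0 a) *: G b = \sum_b (q *m s) 0 b *: G b.
  by rewrite exchange_big; apply: eq_bigr => b _ /=; rewrite qs scaler_suml.
have e2 : \sum_a \sum_b (s a b * q 0 b) *: G a = - \sum_b (q *m s) 0 b *: G b.
  rewrite -sumrN; apply: eq_bigr => a _ /=.
  rewrite qs scaler_suml -sumrN; apply: eq_bigr => b _; rewrite -scaleNr -mulNr.
  by congr (_ * _ *: _); have /matrixP/(_ b a) := sskew; rewrite !mxE.
transitivity (\sum_a \sum_b (2 *: ((s a b * q 0 a) *: G b) -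
    2 *: ((s a b * q 0 b) *: G a))).
  apply: eq_bigr => a _; apply: eq_bigr => b _.
  by rewrite scalerBr !scalerA; congr (_ *: _ - _ *: _); ring.
transitivity (\sum_a (2 *: (\sum_b (s a b * q 0 a) *: G b) -
    2 *: (\sum_b (s a b * q 0 b) *: G a))).
  by apply: eq_bigr => a _; rewrite sumrB !scaler_sumr.
rewrite sumrB -!scaler_sumr e1 e2 scalerN opprK -scalerDl.
by congr (_ *: _); ring.
Qed.

End LinearAlgebra.

Lemma skew_conj (F : comNzRingType) n (a s : 'M[F]_n) :
  a^T = a -> s^T = - s -> (a *m s *m a)^T = - (a *m s *m a).
Proof. by move=> ea es; rewrite !trmx_mul ea es mulNmx mulmxN mulmxA. Qed.

Lemma mulmxK_solve (F : comUnitRingType) n p q (g : 'M[F]_n) (v : 'rV[F]_n)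
    (M : 'M[F]_(n, p)) (c : 'M[F]_(p, q)) :
  g \in unitmx -> v *m g *m (invmx g *m M *m c) = v *m M *m c.
Proof. by move=> gu; rewrite !mulmxA mulmxK. Qed.

(** A skew form which pairs W to zero with P vanishes on P as soon as W has
    codimension at most one in P: P / W is at most a line, and a skew form
    vanishes on a line. *)
Lemma skew_form_vanish (F : numFieldType) p q r (s : 'M[F]_p) (W : 'M[F]_(q, p))
    (P : 'M[F]_(r, p)) :
  s^T = - s -> (W <= P)%MS -> (\rank P <= (\rank W).+1)%N ->
  (forall v w : 'rV_p, (v <= W)%MS -> (w <= P)%MS -> (v *m s *m w^T) 0 0 = 0) ->
  forall u w : 'rV_p, (u <= P)%MS -> (w <= P)%MS -> (u *m s *m w^T) 0 0 = 0.
Proof.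
move=> sskew WP rk sWP u w uP wP.
have skew (y z : 'rV[F]_p) : (y *m s *m z^T) 0 0 = - (z *m s *m y^T) 0 0.
  have -> : (y *m s *m z^T) 0 0 = (y *m s *m z^T)^T 0 0 by rewrite [RHS]mxE.
  by rewrite !trmx_mul trmxK sskew mulNmx mulmxN mulmxA mxE.
have uu : (u *m s *m u^T) 0 0 = 0.
  have /eqP := skew u u; rewrite -subr_eq0 opprK -mulr2n mulrn_eq0 /= => /eqP //.
have [uW|uW] := boolP (u <= W)%MS; first exact: sWP.
have lt : (W < W + u)%MS.
  by rewrite ltmxE addsmxSl addsmx_sub submx_refl.
have sub : (W + u <= P)%MS by rewrite addsmx_sub WP.
have : (P <= W + u)%MS.
  rewrite -(geq_leqif (mxrank_leqif_sup sub)).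
  by apply: (leq_trans rk); move: lt; rewrite ltmxErank => /andP[].
move/(submx_trans wP)/sub_addsmxP => [[a b] /= ->].
rewrite linearD /= mulmxDr mxE skew sWP ?submxMl // oppr0 add0r.
by rewrite [b]mx11_scalar mul_scalar_mx linearZ -scalemxAr mxE uu mulr0.
Qed.

(** * Antisymmetrised words with one distinguished letter *)
Section SkewWords.
Variables (F : numFieldType) (N k : nat).
Variables (f : 'I_k.+2 -> 'M[F]_N) (L : {linear 'M[F]_N -> F^o}).
Variables (j0 : 'I_k.+2) (g : 'I_k.+2 -> F).

(* A segment of the word f (p 0) f (p 1) ... f (p k.+1), with positions in nat. *)
Let seg (p : 'S_k.+2) a b := \prod_(a <= i < b) f (p (inord i)).
Let word p := seg p 0 k.+2.
(* The part of the alternating sum of the values of L on words in which the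
   distinguished letter j0 stands at position l. *)
Let place l := \sum_(p : 'S_k.+2 | p (inord l) == j0) (-1) ^+ p * L (word p).
(* What remains of place l - place l.+1 once the letter j0 and its neighbour
   have been contracted to a scalar. *)
Let gap l := \sum_(p : 'S_k.+2 | p (inord l) == j0)
  (-1) ^+ p * (g (p (inord l.+1)) * L (seg p 0 l * seg p l.+2 k.+2)).

Lemma seg_eq (p q : 'S_k.+2) a b :
  (forall i, (a <= i < b)%N -> p (inord i) = q (inord i)) -> seg p a b = seg q a b.
Proof. by move=> e; apply: eq_big_nat => i /e ->. Qed.

Lemma seg_cat (p : 'S_k.+2) a b c :
  (a <= b <= c)%N -> seg p a c = seg p a b * seg p b c.
Proof. by case/andP => ab bc; rewrite /seg (big_cat_nat ab bc). Qed.

Lemma seg_ltn (p : 'S_k.+2) a b :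
  (a < b)%N -> seg p a b = f (p (inord a)) * seg p a.+1 b.
Proof. by move=> ab; rewrite /seg big_ltn. Qed.

Lemma inord_eq (i j : nat) : (i < k.+2)%N -> (j < k.+2)%N ->
  (inord i == inord j :> 'I_k.+2) = (i == j).
Proof. by move=> ? ?; rewrite -val_eqE /= !inordK. Qed.

Hypothesis anti : forall i, i != j0 -> f j0 * f i + f i * f j0 = (g i)%:M.

(** Reindexing by the transposition of l and l.+1, which is odd, turns the
    difference into a sum of anticommutators of neighbouring letters. *)
Lemma place_step l : (l < k.+1)%N -> place l - place l.+1 = gap l.
Proof.
move=> lk; have l1 : (l.+1 < k.+2)%N by [].
have l0 : (l < k.+2)%N by apply: ltnW.
pose t := tperm (inord l) (inord l.+1) : 'S_k.+2.
have t_out i : (i < k.+2)%N -> i != l -> i != l.+1 -> t (inord i) = inord i.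
  by move=> ik il il1; rewrite tpermD // inord_eq 1?eq_sym // ltnW.
have todd : odd_perm t = true.
  by rewrite odd_tperm inord_eq // (ltn_eqF (ltnSn l)).
have -> : place l.+1 =
    - \sum_(p : 'S_k.+2 | p (inord l) == j0) (-1) ^+ p * L (word (t * p)%g).
  rewrite /place (reindex_inj (mulgI t)) /= -sumrN.
  apply: eq_big => [p|p _]; first by rewrite permM tpermR.
  by rewrite odd_permM todd signrN mulNr.
rewrite opprK -big_split /=; apply: eq_bigr => p /eqP pl.
rewrite -mulrDr -linearD; congr (_ * _).
have splitw q : word q = seg q 0 l * (f (q (inord l)) * f (q (inord l.+1))) *
    seg q l.+2 k.+2.
  rewrite /word (@seg_cat q 0 l) ?(ltnW l0) //= (@seg_ltn q l) //.
  by rewrite (@seg_ltn q l.+1) // !mulrA.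
rewrite !splitw (@seg_eq (t * p)%g p 0 l) => [|i il]; last first.
  have il' : (i < l)%N by [].
  have il1 : (i < l.+1)%N by apply: ltnW.
  by rewrite permM t_out ?(ltn_trans il' l0) ?(ltn_eqF il') ?(ltn_eqF il1).
rewrite (@seg_eq (t * p)%g p l.+2) => [|i /andP[li ik]]; last first.
  have li1 : (l < i)%N by apply: ltnW.
  by rewrite permM t_out // ?(gtn_eqF li1) ?(gtn_eqF li).
rewrite !permM tpermL tpermR pl -mulrDl -mulrDr anti.
  by rewrite -mulmxE mul_mx_scalar -scalemxAl linearZ.
by rewrite -pl (inj_eq perm_inj) inord_eq // gtn_eqF.
Qed.

(** Contracting j0 with its right neighbour at position l or at position l.+1
    leaves the same words; the two sums correspond under a 3-cycle, which is even. *)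
Lemma gap_const l : (l.+1 < k.+1)%N -> gap l = gap l.+1.
Proof.
move=> lk.
have l2 : (l.+2 < k.+2)%N by [].
have l1 : (l.+1 < k.+2)%N by apply: ltnW.
have l0 : (l < k.+2)%N by apply: ltnW.
(* The 3-cycle l -> l.+1 -> l.+2 -> l. *)
pose t := (tperm (inord l) (inord l.+1) * tperm (inord l) (inord l.+2))%g : 'S_k.+2.
have n01 : inord l != inord l.+1 :> 'I_k.+2 by rewrite inord_eq // ltn_eqF.
have n02 : inord l != inord l.+2 :> 'I_k.+2 by rewrite inord_eq // ltn_eqF.
have n12 : inord l.+1 != inord l.+2 :> 'I_k.+2 by rewrite inord_eq // ltn_eqF.
have t0 : t (inord l) = inord l.+1 by rewrite permM tpermL tpermD // eq_sym.
have t1 : t (inord l.+1) = inord l.+2 by rewrite permM tpermR tpermL.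
have t2 : t (inord l.+2) = inord l by rewrite permM (tpermD n02 n12) tpermR.
have t_out i : (i < k.+2)%N -> i != l -> i != l.+1 -> i != l.+2 ->
    t (inord i) = inord i.
  by move=> ik il il1 il2; rewrite permM !tpermD // inord_eq // eq_sym.
rewrite /gap (reindex_inj (mulgI t)) /=.
apply: eq_big => [p|p _]; first by rewrite permM t0.
rewrite odd_permM /t odd_permM !odd_tperm n01 n02 /= -/t.
congr (_ * (_ * L _)); first by rewrite permM t1.
rewrite (@seg_cat p 0 l l.+1) ?leqnSn // (@seg_ltn (t * p)%g l.+2) //.
rewrite (@seg_ltn p l) // [seg p l.+1 l.+1]/seg big_geq // mulr1 permM t2 -mulrA.
rewrite (@seg_eq (t * p)%g p 0 l) => [|i il]; last first.
  have il' : (i < l)%N by [].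
  have il1 : (i < l.+1)%N by apply: ltnW.
  have il2 : (i < l.+2)%N by apply: ltnW.
  by rewrite permM t_out ?(ltn_trans il' l0) ?(ltn_eqF il') ?(ltn_eqF il1) ?(ltn_eqF il2).
rewrite (@seg_eq (t * p)%g p l.+3) // => i /andP[li ik].
have li2 : (l.+1 < i)%N by apply: ltnW.
have li1 : (l < i)%N by apply: ltnW.
by rewrite permM t_out // ?(gtn_eqF li1) ?(gtn_eqF li2) ?(gtn_eqF li).
Qed.

Hypothesis Lleft : forall i M, i != j0 -> L (f j0 * f i * M) = 0.
Hypothesis Lright : forall M, L (M * f j0) = 0.

(** If L kills the words beginning or ending with j0, it kills the antisymmetrised
    word: place is an arithmetic progression, and its first and last terms are 0. *)
Lemma skew_word_eq0 :
  L (\sum_(p : 'S_k.+2) (-1) ^+ p *: \big[mulmx/1%:M]_(i < k.+2) f (p i)) = 0.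
Proof.
have E0 : place 0 = 0.
  apply: big1 => p /eqP p0; rewrite /word (@seg_ltn p 0) // (@seg_ltn p 1) //.
  rewrite p0 mulrA Lleft ?mulr0 // -p0 (inj_eq perm_inj) inord_eq //.
have Elast : place k.+1 = 0.
  apply: big1 => p /eqP pk; rewrite /word (@seg_cat p 0 k.+1) ?leqnSn //.
  by rewrite (@seg_ltn p k.+1) // [seg p k.+2 _]/seg big_geq // mulr1 pk Lright mulr0.
have gapE l : (l < k.+1)%N -> gap l = gap 0.
  elim: l => // l IH lk; rewrite -gap_const // IH // ltnW //.
have placeE l : (l <= k.+1)%N -> place l = - (gap 0 *+ l).
  elim: l => [|l IH] lk; first by rewrite mulr0n oppr0.
  have := place_step lk; rewrite (gapE l) // IH ?(ltnW lk) // mulrSr => /eqP.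
  by rewrite subr_eq => /eqP e; rewrite -[LHS](addKr (gap 0)) -e opprD addrC.
have g0 : gap 0 = 0.
  have := placeE _ (leqnn k.+1); rewrite Elast => /esym /eqP.
  by rewrite oppr_eq0 mulrn_eq0 /= => /eqP.
have pl0 l : (l < k.+2)%N -> place l = 0 by move=> lk; rewrite placeE // g0 mul0rn oppr0.
rewrite linear_sum (partition_big (fun p : 'S_k.+2 => (p^-1)%g j0) xpredT) //=.
apply: big1 => l _; rewrite -[RHS](pl0 l (ltn_ord l)) /place.
apply: eq_big => [p|p _].
  by rewrite inord_val; apply/eqP/eqP => <-; rewrite ?permKV ?permK.
rewrite linearZ /= /word /seg; congr (_ * L _); rewrite big_mkord mulmxE idmxE.
by apply: eq_bigr => i _; rewrite inord_val.
Qed.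

End SkewWords.

(** * Clifford modules and the skew forms of a spinor *)
Section CliffordModule.
Variables (R : realType) (n : nat) (h : 'M[R[i]]_n.+2).
Local Notation C := R[i].
Local Notation V := 'rV[C]_n.+2.

Lemma hformDl u v w : hform h (u + v) w = hform h u w + hform h v w.
Proof. by rewrite /hform !mulmxDl mxE. Qed.

Lemma hformDr u v w : hform h w (u + v) = hform h w u + hform h w v.
Proof. by rewrite /hform linearD /= mulmxDr mxE. Qed.

Lemma hformZl a u v : hform h (a *: u) v = a * hform h u v.
Proof. by rewrite /hform -!scalemxAl mxE. Qed.

Lemma hformZr a u v : hform h u (a *: v) = a * hform h u v.
Proof. by rewrite /hform linearZ /= -scalemxAr mxE. Qed.

Hypothesis h_sym : h^T = h.

Lemma hformC u v : hform h u v = hform h v u.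
Proof.
have -> : hform h u v = (u *m h *m v^T)^T 0 0 by rewrite [RHS]mxE.
by rewrite !trmx_mul trmxK h_sym mulmxA.
Qed.

Hypothesis h_nondeg : h \in unitmx.

Lemma hform_nondeg u : (forall v, hform h u v = 0) -> u = 0.
Proof.
move=> u0; rewrite -[u](mulmxK h_nondeg) (_ : u *m h = 0) ?mul0mx //.
apply/rowP => j; rewrite !mxE -[RHS](u0 (delta_mx 0 j)) /hform trmx_delta.
by rewrite -colE !mxE.
Qed.

Lemma exists_nonnull : exists f, hform h f f != 0.
Proof.
apply: contrapT => none.
have null f : hform h f f = 0.
  by apply/eqP; apply: contra_notT none => fn; exists f.
have z u v : hform h u v = 0.
  have := null (u + v); rewrite hformDl !hformDr !null (hformC v u) add0r addr0.
  by move/eqP; rewrite -mulr2n mulrn_eq0 /= => /eqP.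
have := @hform_nondeg (const_mx 1) (fun v => z _ v).
by move/rowP/(_ ord0)/eqP; rewrite !mxE oner_eq0.
Qed.

Lemma exists_nonnull_shift (a b : C) : b != 0 ->
  exists s : C, s != 0 /\ s * (2 * a + s * b) != 0.
Proof.
move=> bn; have [e|] := eqVneq (2 * a + b) 0; last first.
  by exists 1; rewrite oner_eq0 !mul1r.
exists (-1); rewrite oppr_eq0 oner_eq0 mulf_neq0 // ?oppr_eq0 ?oner_eq0 //.
have -> : 2 * a + -1 * b = - (2 * b) by rewrite -[LHS]subr0 -e; ring.
by rewrite oppr_eq0 mulf_neq0 // pnatr_eq0.
Qed.

(** The non-null vectors generate V as an additive group. *)
Lemma nonnull_span (W : zmodType) (phi : V -> W) :
  {morph phi : u v / u - v} ->
  (forall u, hform h u u != 0 -> phi u = 0) -> forall u, phi u = 0.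
Proof.
move=> phiB H u; have [u0|un] := eqVneq (hform h u u) 0; last exact: H.
have [f fn] := exists_nonnull.
have [s [sn en]] := exists_nonnull_shift (hform h u f) fn.
have H1 : phi (s *: f) = 0.
  by apply: H; rewrite hformZl hformZr; apply: mulf_neq0 => //; apply: mulf_neq0.
have H2 : phi (u + s *: f) = 0.
  apply: H; rewrite hformDl !hformDr !hformZl !hformZr u0 (hformC f u).
  move: en; move: (hform h u f) (hform h f f) => a b.
  by rewrite (_ : 0 + _ + _ = s * (2 * a + s * b)) //; ring.
by rewrite -[u](addrK (s *: f)) phiB H1 H2 subr0.
Qed.

Variables (m : nat) (Gam : 'I_n.+2 -> 'M[C]_(2 ^ m.+1)).
Local Notation N := (2 ^ m.+1)%N.
Local Notation sl := (slash Gam).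

Lemma slashD u v : sl (u + v) = sl u + sl v.
Proof. by rewrite /slash -big_split; apply: eq_bigr => a _; rewrite mxE scalerDl. Qed.

Lemma slashZ a u : sl (a *: u) = a *: sl u.
Proof. by rewrite /slash scaler_sumr; apply: eq_bigr => b _; rewrite mxE scalerA. Qed.

HB.instance Definition _ := GRing.isSemilinear.Build C V 'M[C]_N _ (slash Gam)
  (conj slashZ slashD).

Lemma slash_sum p (w : 'rV[C]_p) (Z : 'M[C]_(p, n.+2)) :
  sl (w *m Z) = \sum_a w 0 a *: sl (row a Z).
Proof. by rewrite mulmx_sum_row linear_sum; apply: eq_bigr => a _; rewrite linearZ. Qed.

Hypothesis hGam : clifford_module h Gam.

Lemma slash_anticomm u v :
  sl u *m sl v + sl v *m sl u = (- 2 * hform h u v)%:M.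
Proof.
have e A B : Gam A *m Gam B + Gam B *m Gam A = (- 2 * h A B)%:M.
  have two : 2 != 0 :> C by rewrite pnatr_eq0.
  by rewrite -[LHS](scalerKV two) hGam scale_scalar_mx mulrN mulNr.
have -> : sl u *m sl v + sl v *m sl u =
    \sum_A \sum_B (u 0 A * v 0 B) *: (Gam A *m Gam B + Gam B *m Gam A).
  rewrite /slash !mulmx_suml (eq_bigr _ (fun A _ => mulmx_sumr _ _ _ _)).
  rewrite [X in _ + X](eq_bigr _ (fun A _ => mulmx_sumr _ _ _ _)) /=.
  rewrite [X in _ + X]exchange_big -big_split; apply: eq_bigr => A _ /=.
  rewrite -big_split; apply: eq_bigr => B _ /=.
  rewrite scalerDr -!scalemxAl -!scalemxAr !scalerA.
  by rewrite [v 0 B * u 0 A]mulrC.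
under eq_bigr do under eq_bigr do rewrite e scale_scalar_mx.
under eq_bigr do rewrite -raddf_sum.
rewrite -raddf_sum; congr _%:M; rewrite /hform mxE mulr_sumr exchange_big /=.
apply: eq_bigr => B _; rewrite !mxE mulr_suml mulr_sumr; apply: eq_bigr => A _.
by ring.
Qed.

Variable B : 'M[C]_N.
Hypothesis hB : spin_invariant_pairing h Gam B.

Lemma slash_sq u : sl u *m sl u = (- hform h u u)%:M.
Proof.
have two : 2 != 0 :> C by rewrite pnatr_eq0.
have := slash_anticomm u u; rewrite -mulr2n -scaler_nat => /(canRL (scalerK two)) ->.
by rewrite scale_scalar_mx; congr _%:M; rewrite mulNr mulrN mulKf.
Qed.

(** A non-null vector is a multiple of a unit vector, for which the identity is
    spin invariance, since the inverse of a product u v of unit vectors is v u. *)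
Lemma pairing_adjoint_nonnull u v : hform h u u != 0 -> hform h v v != 0 ->
  (sl u *m sl v)^T *m B = B *m (sl v *m sl u).
Proof.
have norm w : hform h w w != 0 -> exists s w', [/\ w = s *: w' & hform h w' w' = 1].
  move=> wn; pose s := sqrtC (hform h w w).
  have sn : s != 0 by rewrite sqrtC_eq0.
  exists s, (s^-1 *: w); split; first by rewrite scalerA mulfV // scale1r.
  by rewrite hformZl hformZr mulrA -invfM -expr2 sqrtCK mulVf.
move=> /norm[s [u' [-> u1]]] /norm[t [v' [-> v1]]].
rewrite !linearZ /= -!scalemxAl -!scalemxAr !linearZ /= -!scalemxAl; congr (_ *: (_ *: _)).
have inv : (sl u' *m sl v') *m (sl v' *m sl u') = 1%:M.
  rewrite mulmxA -(mulmxA (sl u')) slash_sq v1 mul_mx_scalar -scalemxAl slash_sq u1.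
  by rewrite scale_scalar_mx mulrNN mulr1.
by rewrite -{2}(hB.2 _ _ u1 v1) -[RHS]mulmxA inv mulmx1.
Qed.

(** The pairing itself need not be compatible with the action of one vector (on the
    sum of the two half-spin modules it may be scaled differently on each summand),
    but moving two vectors across it reverses their product. *)
Lemma pairing_adjoint u v : (sl u *m sl v)^T *m B = B *m (sl v *m sl u).
Proof.
pose phi u v := (sl u *m sl v)^T *m B - B *m (sl v *m sl u).
suff E : phi u v = 0 by apply/eqP; rewrite -subr_eq0; apply/eqP.
have trB (P Q : 'M[C]_N) : (P - Q)^T = P^T - Q^T by apply/matrixP=> i j; rewrite !mxE.
have swap4 (a b c d : 'M[C]_N) : a - b - (c - d) = a - c - (b - d).
  by rewrite !opprB addrACA [RHS]addrACA [- b - c]addrC.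
have slB x y : sl (x - y) = sl x - sl y by rewrite linearB.
have phiBl w : {morph phi^~ w : x y / x - y}.
  by move=> x y; rewrite /phi slB mulmxBl trB mulmxBl !mulmxBr swap4.
have phiBr w : {morph phi w : x y / x - y}.
  by move=> x y; rewrite /phi slB mulmxBr trB !mulmxBl mulmxBr swap4.
move: u; apply: (nonnull_span (phi := phi^~ v)) => // u un.
move: v; apply: nonnull_span => // v vn.
by rewrite /phi pairing_adjoint_nonnull // subrr.
Qed.

(** A product is linear in a factor which occurs exactly once. *)
Lemma prod_slot_linear k (W : 'I_n.+2 -> 'I_k -> 'M[C]_N) (F : 'I_k -> 'M[C]_N)
    (c : 'I_n.+2 -> C) (j0 : 'I_k) (r : seq 'I_k) :
  (forall a i, i != j0 -> W a i = F i) -> F j0 = \sum_a c a *: W a j0 ->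
  uniq r -> j0 \in r ->
  \sum_a c a *: \big[mulmx/1%:M]_(i <- r) W a i = \big[mulmx/1%:M]_(i <- r) F i.
Proof.
move=> WF Fj0 /[swap] /path.splitPr [r1 r2].
rewrite cat_uniq /= negb_or => /and3P[_ /andP[jr1 _] /andP[jr2 _]].
have WFr a r' : j0 \notin r' -> \prod_(i <- r') W a i = \prod_(i <- r') F i.
  move=> jr'; apply: eq_big_seq => i ir; apply: WF.
  by apply: contraNneq jr' => <-.
rewrite mulmxE idmxE [RHS]big_cat big_cons /= Fj0 mulr_suml mulr_sumr.
apply: eq_bigr => a _; rewrite big_cat big_cons /= !WFr // -mulmxE.
by rewrite -!(scalemxAl, scalemxAr).
Qed.

(** The entry j0 of the multi-index T runs over the coordinates of the vector w.
    A word beginning with w v pairs to zero with Z, because w v moves to the other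
    side as v w, and w Z = 0; a word ending with w kills Z. *)
Lemma skew_slot_ann_eq0 k (T : 'I_n.+2 -> 'I_k.+2 -> 'I_n.+2) (j0 : 'I_k.+2)
    (Z : 'cV[C]_N) (w : V) :
  (forall a b i, i != j0 -> T a i = T b i) -> (forall a, T a j0 = a) ->
  sl w *m Z = 0 ->
  \sum_a w 0 a * (((\sum_(p : 'S_k.+2) (-1) ^+ p *:
      \big[mulmx/1%:M]_(i < k.+2) Gam (T a (p i))) *m Z)^T *m B *m Z) 0 0 = 0.
Proof.
move=> Tout Tj0 wZ.
pose L (M : 'M[C]_N) := ((M *m Z)^T *m B *m Z) 0 0.
have L_lin : linear_for *%R L.
  move=> a x y; rewrite /L mulmxDl -scalemxAl.
  have -> (P Q : 'cV[C]_N) : (a *: P + Q)^T = a *: P^T + Q^T.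
    by apply/matrixP=> i j; rewrite !mxE.
  by rewrite !mulmxDl -!scalemxAl 2!mxE.
pose LH := GRing.isLinear.Build C 'M[C]_N C _ L L_lin.
pose LL : {linear 'M[C]_N -> C^o} := HB.pack L LH.
pose F i := if i == j0 then sl w else Gam (T ord0 i).
have Fj0 : F j0 = sl w by rewrite /F eqxx.
have Fi i : i != j0 -> F i = sl (delta_mx 0 (T ord0 i)).
  move=> ij; rewrite /F (negbTE ij) /slash (bigD1 (T ord0 i)) //= mxE !eqxx scale1r.
  by rewrite big1 ?addr0 // => A /negbTE An; rewrite mxE An andbF scale0r.
have LE a : (((\sum_(p : 'S_k.+2) (-1) ^+ p *:
    \big[mulmx/1%:M]_(i < k.+2) Gam (T a (p i))) *m Z)^T *m B *m Z) 0 0 =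
    LL (\sum_(p : 'S_k.+2) (-1) ^+ p *: \big[mulmx/1%:M]_(i < k.+2) Gam (T a (p i))).
  by [].
under eq_bigr do rewrite LE.
have -> : \sum_a w 0 a * LL (\sum_(p : 'S_k.+2) (-1) ^+ p *:
      \big[mulmx/1%:M]_(i < k.+2) Gam (T a (p i))) =
    LL (\sum_(p : 'S_k.+2) (-1) ^+ p *: \big[mulmx/1%:M]_(i < k.+2) F (p i)).
  under eq_bigr => a _ do rewrite -[_ * _]/(w 0 a *: (LL _ : C^o)) -linearZ.
  rewrite -linear_sum; congr (LL _).
  under eq_bigr do rewrite scaler_sumr.
  rewrite exchange_big; apply: eq_bigr => p _ /=.
  under eq_bigr do rewrite scalerA mulrC -scalerA.
  rewrite -scaler_sumr; congr (_ *: _).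
  have mapE (G : 'I_k.+2 -> 'M[C]_N) : \big[mulmx/1%:M]_(i < k.+2) G (p i) =
    \big[mulmx/1%:M]_(i <- [seq p i | i <- index_enum 'I_k.+2]) G i by rewrite big_map.
  rewrite (mapE F); under eq_bigr do rewrite (mapE (fun i => Gam (T _ i))).
  apply: (@prod_slot_linear _ (fun a i => Gam (T a i)) F _ j0).
  - by move=> a i ij; rewrite /F (negbTE ij) (Tout a ord0).
  - by rewrite Fj0; apply: eq_bigr => a _; rewrite Tj0.
  - by rewrite map_inj_uniq ?index_enum_uniq //; apply: perm_inj.
  - by apply/mapP; exists ((p^-1)%g j0); rewrite ?mem_index_enum ?permKV.
apply: (@skew_word_eq0 _ _ _ F LL j0
    (fun i => - 2 * hform h w (delta_mx 0 (T ord0 i)))).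
- by move=> i ij; rewrite Fj0 (Fi i ij) -!mulmxE slash_anticomm.
- move=> i M ij; rewrite Fj0 (Fi i ij) -!mulmxE /= /L.
  have movP (P : 'M[C]_N) :
      (P *m M *m Z)^T *m B *m Z = (M *m Z)^T *m (P^T *m B) *m Z.
    by rewrite -(mulmxA P M Z) trmx_mul -!mulmxA.
  by rewrite movP pairing_adjoint -!mulmxA wZ !mulmx0 mxE.
- by move=> M; rewrite Fj0 -mulmxE /= /L -(mulmxA M) wZ mulmx0 trmx0 !mul0mx mxE.
Qed.

Local Notation form s Z := (gamma_form Gam B s Z Z).

(** As an alternating form, Gamma(Z, Z) is annihilated by every vector which
    annihilates Z. *)
Lemma gamma_form_ann (s : seq 'I_n.+2) (Z : 'cV[C]_N) (w : V) : sl w *m Z = 0 ->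
  [/\ forall b c, \sum_a w 0 a * form [:: a, b, c & s] Z = 0,
      forall a c, \sum_b w 0 b * form [:: a, b, c & s] Z = 0 &
      forall a b, \sum_c w 0 c * form [:: a, b, c & s] Z = 0].
Proof.
move=> wZ.
pose t a b c := tnth (in_tuple [:: a, b, c & s]).
have formE a b c : form [:: a, b, c & s] Z = ((size s).+3`!%:R)^-1 *
  (((\sum_(p : 'S_(size s).+3) (-1) ^+ p *:
      \big[mulmx/1%:M]_(i < (size s).+3) Gam (t a b c (p i))) *m Z)^T *m B *m Z) 0 0.
  by rewrite /gamma_form /gamma_skew -scalemxAl linearZ /= -!scalemxAl mxE.
have tE a b c (i : 'I_(size s).+3) : t a b c i = nth a [:: a, b, c & s] i.
  exact: tnth_nth.
split=> [b c|a c|a b].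
- under eq_bigr do rewrite formE mulrCA.
  rewrite -mulr_sumr (@skew_slot_ann_eq0 _ (fun x => t x b c) ord0) ?mulr0 //.
  by move=> x y [[|[|[|i]]] Hi] // _; rewrite !tE //=; apply: set_nth_default.
- under eq_bigr do rewrite formE mulrCA.
  pose j1 := Ordinal (isT : (1 < (size s).+3)%N).
  rewrite -mulr_sumr (@skew_slot_ann_eq0 _ (fun x => t a x c) j1) ?mulr0 //.
  by move=> x y [[|[|[|i]]] Hi] // _; rewrite !tE.
- under eq_bigr do rewrite formE mulrCA.
  pose j2 := Ordinal (isT : (2 < (size s).+3)%N).
  rewrite -mulr_sumr (@skew_slot_ann_eq0 _ (fun x => t a b x) j2) ?mulr0 //.
  by move=> x y [[|[|[|i]]] Hi] // _; rewrite !tE.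
Qed.
End CliffordModule.

(** * The annihilator of a spinor *)
Section Annihilator.
Variables (R : realType) (n m : nat) (h : 'M[R[i]]_n.+2).
Variables (Gam : 'I_n.+2 -> 'M[R[i]]_(2 ^ m.+1)).
Local Notation C := R[i].
Local Notation V := 'rV[C]_n.+2.
Local Notation N := (2 ^ m.+1)%N.
Local Notation sl := (slash Gam).

Lemma annP (Z : 'cV[C]_N) (y : V) : (y <= ann_mx Gam Z)%MS <-> sl y *m Z = 0.
Proof. exact: ker_action. Qed.

Lemma hform_mx p q (u : 'rV[C]_p) (A : 'M[C]_(p, n.+2)) (v : 'rV[C]_q)
    (B : 'M[C]_(q, n.+2)) :
  hform h (u *m A) (v *m B) = (u *m (A *m h *m B^T) *m v^T) 0 0.
Proof. by rewrite /hform trmx_mul !mulmxA. Qed.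

Hypotheses (h_sym : h^T = h) (h_nondeg : h \in unitmx).

(** A tensor G whose contraction in each slot with the annihilator of Z vanishes is,
    once raised by the metric, a tensor over the orthogonal of the annihilator; it
    contracts to zero with a form T that vanishes there. *)
Lemma raised_contraction (T G : 'I_n.+2 -> 'I_n.+2 -> 'I_n.+2 -> C) (Z : 'cV[C]_N) :
  (forall w : V, sl w *m Z = 0 ->
    [/\ forall b c, \sum_a w 0 a * G a b c = 0,
        forall a c, \sum_b w 0 b * G a b c = 0 &
        forall a b, \sum_c w 0 c * G a b c = 0]) ->
  (forall u v w : V,
    (forall y, sl y *m Z = 0 -> hform h u y = 0) ->
    (forall y, sl y *m Z = 0 -> hform h v y = 0) ->
    (forall y, sl y *m Z = 0 -> hform h w y = 0) ->
    \sum_a \sum_b \sum_c u 0 a * v 0 b * w 0 c * T a b c = 0) ->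
  \sum_a \sum_b \sum_c raise3 h T a b c * G a b c = 0.
Proof.
move=> HG HT.
pose hi := invmx h.
pose GG x y z := \sum_a \sum_b \sum_c G a b c * (hi a x * hi b y * hi c z).
transitivity (\sum_x \sum_y \sum_z GG x y z * T x y z).
  transitivity (\sum_a \sum_b \sum_c \sum_x \sum_y \sum_z
      G a b c * (hi a x * hi b y * hi c z) * T x y z).
    do 3![apply: eq_bigr => ? _]; rewrite /raise3 mulr_suml.
    do 2![apply: eq_bigr => ? _; rewrite mulr_suml].
    by apply: eq_bigr => ? _; rewrite /hi; ring.
  under eq_bigr do under eq_bigr do rewrite exchange_big /=.
  under eq_bigr do rewrite exchange_big /=.
  rewrite exchange_big; apply: eq_bigr => x _.
  under eq_bigr do under eq_bigr do rewrite exchange_big /=.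
  under eq_bigr do rewrite exchange_big /=.
  rewrite exchange_big; apply: eq_bigr => y _.
  under eq_bigr do under eq_bigr do rewrite exchange_big /=.
  under eq_bigr do rewrite exchange_big /=.
  rewrite exchange_big; apply: eq_bigr => z _.
  by rewrite mulr_suml; do 2![apply: eq_bigr => ? _; rewrite mulr_suml].
have inD (gv : V) : (forall y : V, sl y *m Z = 0 -> \sum_a y 0 a * gv 0 a = 0) ->
    (gv *m hi <= kermx (h *m (ann_mx Gam Z)^T))%MS.
  move=> H; apply/sub_orthP => y /annP yZ; rewrite mulmxKV // -[RHS](H y yZ) mxE.
  by apply: eq_bigr => a _; rewrite mxE mulrC.
apply: (@trilinear_contraction _ _ _ (kermx (h *m (ann_mx Gam Z)^T))).
- move=> u v w /sub_orthP uD /sub_orthP vD /sub_orthP wD.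
  by apply: HT => y /annP yZ; [apply: uD | apply: vD | apply: wD].
- move=> y z.
  pose gv : V := \row_a \sum_b \sum_c G a b c * (hi b y * hi c z).
  rewrite (_ : \row_x _ = gv *m hi).
    apply: inD => w wZ; under eq_bigr do rewrite mxE mulr_sumr.
    rewrite exchange_big big1 //= => b _; under eq_bigr do rewrite mulr_sumr.
    rewrite exchange_big big1 //= => c _; under eq_bigr do rewrite mulrA.
    by have [e _ _] := HG w wZ; rewrite -mulr_suml e mul0r.
  apply/rowP => x; rewrite !mxE; apply: eq_bigr => a _; rewrite mxE mulr_suml.
  apply: eq_bigr => b _; rewrite mulr_suml; apply: eq_bigr => c _.
  by rewrite /hi; ring.
- move=> x z.
  pose gv : V := \row_b \sum_a \sum_c G a b c * (hi a x * hi c z).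
  rewrite (_ : \row_x _ = gv *m hi).
    apply: inD => w wZ; under eq_bigr do rewrite mxE mulr_sumr.
    rewrite exchange_big big1 //= => b _; under eq_bigr do rewrite mulr_sumr.
    rewrite exchange_big big1 //= => c _; under eq_bigr do rewrite mulrA.
    by have [_ e _] := HG w wZ; rewrite -mulr_suml e mul0r.
  apply/rowP => y; rewrite !mxE /GG exchange_big.
  apply: eq_bigr => b _; rewrite mxE mulr_suml.
  apply: eq_bigr => a _; rewrite mulr_suml; apply: eq_bigr => c _.
  by rewrite /hi; ring.
- move=> x y.
  pose gv : V := \row_c \sum_a \sum_b G a b c * (hi a x * hi b y).
  rewrite (_ : \row_x _ = gv *m hi).
    apply: inD => w wZ; under eq_bigr do rewrite mxE mulr_sumr.
    rewrite exchange_big big1 //= => b _; under eq_bigr do rewrite mulr_sumr.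
    rewrite exchange_big big1 //= => c _; under eq_bigr do rewrite mulrA.
    by have [_ _ e] := HG w wZ; rewrite -mulr_suml e mul0r.
  apply/rowP => z; rewrite !mxE /GG.
  under eq_bigr do rewrite exchange_big /=.
  rewrite exchange_big.
  apply: eq_bigr => c _; rewrite mxE mulr_suml.
  apply: eq_bigr => a _; rewrite mulr_suml; apply: eq_bigr => b _.
  by rewrite /hi; ring.
Qed.

Hypothesis hGam : clifford_module h Gam.

(** y z + z y acts as the scalar -2 h(y, z). *)
Lemma ann_isotropic (Z : 'cV[C]_N) (y z : V) : Z != 0 ->
  sl y *m Z = 0 -> sl z *m Z = 0 -> hform h y z = 0.
Proof.
move=> Z0 yZ zZ; have := slash_anticomm hGam y z.
move/(congr1 (mulmx^~ Z)); rewrite mulmxDl -!mulmxA yZ zZ !mulmx0 addr0 mul_scalar_mx.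
move/esym/eqP; rewrite scaler_eq0 (negbTE Z0) orbF mulf_eq0 oppr_eq0 pnatr_eq0 /=.
by move/eqP.
Qed.

Lemma ann_rank_le (Z : 'cV[C]_N) (eps : bool) : n = (m.*2 + eps)%N -> Z != 0 ->
  (\rank (ann_mx Gam Z) <= m.+1)%N.
Proof.
move=> nE Z0.
have le : ((\rank (ann_mx Gam Z)).*2 <= n.+2)%N.
  apply: (isotropic_rank h_sym h_nondeg) => y z /annP yZ /annP zZ.
  exact: (ann_isotropic Z0).
have : ((\rank (ann_mx Gam Z)).*2 <= m.+1.*2.+1)%N.
  apply: (leq_trans le); rewrite [in leqLHS]nE doubleS !ltnS -[leqRHS]addn1 leq_add2l.
  by case: (eps).
rewrite leq_eqVlt ltnS leq_double => /orP[/eqP e|//].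
by have := congr1 odd e; rewrite /= !odd_double.
Qed.

End Annihilator.

(** * Adapted frames *)
Section Frame.
Variables (R : realType) (n : nat) (h : 'M[R[i]]_n.+2).
Local Notation C := R[i].
Local Notation V := 'rV[C]_n.+2.
Hypotheses (h_sym : h^T = h) (h_nondeg : h \in unitmx).
Variables (F : frame R n) (aF : adapted h F).
Local Notation X := (frX F).
Local Notation Y := (frY F).
Local Notation Z := (frZ F).
Local Notation g := (metric h F).

Lemma metric_sym : g^T = g.
Proof. by rewrite /metric !trmx_mul trmxK h_sym mulmxA. Qed.

Lemma tr_mul_metric p (w : 'M[C]_(p, n)) : (w *m g)^T = g *m w^T.
Proof. by rewrite trmx_mul [X in X *m _]metric_sym. Qed.

Lemma metric_swap (v w : 'rV[C]_n) : (v *m g *m w^T) 0 0 = (w *m g *m v^T) 0 0.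
Proof. by rewrite -!hform_mx hformC. Qed.

Lemma hform_frX v : hform h X (v *m Z) = 0.
Proof.
case: aF => _ _ _ orth _; rewrite /hform trmx_mul mulmxA (_ : X *m h *m Z^T = 0).
  by rewrite mul0mx mxE.
apply/rowP => a; rewrite [RHS]mxE; have [e _] := orth a.
by rewrite -[RHS]e /hform tr_row !colE [in RHS]mulmxA -colE [RHS]mxE.
Qed.

Lemma hform_frY v : hform h Y (v *m Z) = 0.
Proof.
case: aF => _ _ _ orth _; rewrite /hform trmx_mul mulmxA (_ : Y *m h *m Z^T = 0).
  by rewrite mul0mx mxE.
apply/rowP => a; rewrite [RHS]mxE; have [_ e] := orth a.
by rewrite -[RHS]e /hform tr_row !colE [in RHS]mulmxA -colE [RHS]mxE.
Qed.

(** X, Y and the Z_a span V, so a vector orthogonal to all of them is zero. *)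
Lemma frame_span u : hform h u X = 0 -> hform h u Y = 0 ->
  (forall v, hform h u (v *m Z) = 0) -> u = 0.
Proof.
case: aF => XX YY XY _ Zfree uX uY uZ.
pose E : 'M[C]_(1 + (1 + n)) := col_mx X (col_mx Y Z).
have EE (w : 'rV[C]_(1 + (1 + n))) : w *m E = lsubmx w 0 0 *: X +
    (lsubmx (rsubmx w) 0 0 *: Y + rsubmx (rsubmx w) *m Z).
  rewrite -[w]hsubmxK -[rsubmx w]hsubmxK /E !mul_row_col !row_mxKl !row_mxKr row_mxKl.
  by rewrite -!mul_scalar_mx -!mx11_scalar.
have Eu : E \in unitmx.
  rewrite -row_free_unit; apply: inj_row_free => w; rewrite EE.
  set a := lsubmx w 0 0; set b := lsubmx _ 0 0; set v := rsubmx _ => e.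
  have a0 : a = 0.
    have := congr1 (hform h Y) e; rewrite !hformDr !hformZr YY hform_frY hformC // XY.
    by rewrite mulr1 mulr0 !addr0 => ->; rewrite /hform trmx0 mulmx0 mxE.
  have b0 : b = 0.
    have := congr1 (hform h X) e; rewrite !hformDr !hformZr XX hform_frX XY.
    by rewrite mulr1 mulr0 !add0r addr0 => ->; rewrite /hform trmx0 mulmx0 mxE.
  have v0 : v = 0.
    move: e; rewrite a0 b0 !scale0r !add0r => e.
    by rewrite -[v](mulmxKp Zfree) e mul0mx.
  rewrite -[w]hsubmxK -[rsubmx w]hsubmxK -/v v0 [lsubmx w]mx11_scalar -/a a0.
  by rewrite [lsubmx _]mx11_scalar -/b b0 !raddf0 !row_mx0.
apply: (hform_nondeg h_nondeg) => v; rewrite -[v](mulmxKV Eu) EE.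
by rewrite !hformDr !hformZr uX uY uZ !mulr0 !addr0.
Qed.

Lemma metric_unit : g \in unitmx.
Proof.
case: (aF) => XX YY XY _ Zfree.
rewrite -row_free_unit; apply: inj_row_free => w wg.
rewrite -[w](mulmxKp Zfree) (_ : w *m Z = 0) ?mul0mx //.
apply: frame_span => [||v].
- by rewrite hformC // hform_frX.
- by rewrite hformC // hform_frY.
- by rewrite hform_mx -/(metric h F) wg mul0mx mxE.
Qed.

Variable x : 'rV[C]_n.
Local Notation Xx := (emb h F x).
Local Notation Zx := (Zslot h F x).

Lemma mul_Zslot v : v *m Zx = v *m Z - (v *m g *m x^T) 0 0 *: Y.
Proof.
rewrite /Zslot mulmxBr; congr (_ - _).
by rewrite tr_mul_metric !mulmxA -mul_scalar_mx -mx11_scalar.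
Qed.

Lemma hform_emb_frY : hform h Xx Y = 1.
Proof.
case: aF => XX YY XY _ _; rewrite /emb -scaleNr !hformDl hformZl YY XY.
by rewrite [hform h (_ *m _) _]hformC // hform_frY mulr0 !addr0.
Qed.

Lemma hform_frY_Zslot v : hform h Y (v *m Zx) = 0.
Proof.
case: aF => _ YY _ _ _.
by rewrite mul_Zslot -scaleNr hformDr hformZr YY mulr0 addr0 hform_frY.
Qed.

Lemma hform_emb_Zslot v : hform h Xx (v *m Zx) = 0.
Proof.
case: aF => XX YY XY _ _; rewrite mul_Zslot -scaleNr hformDr hformZr hform_emb_frY.
rewrite /emb -scaleNr !hformDl hformZl hform_frX hform_frY hform_mx -/(metric h F).
rewrite mulr0 addr0 add0r mulr1.
by rewrite metric_swap subrr.
Qed.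

Lemma hform_Zslot v w : hform h (v *m Zx) (w *m Zx) = (v *m g *m w^T) 0 0.
Proof.
rewrite {1}mul_Zslot -scaleNr hformDl hformZl hform_frY_Zslot mulr0 addr0.
rewrite mul_Zslot -scaleNr hformDr hformZr [hform h _ Y]hformC // hform_frY mulr0 addr0.
by rewrite hform_mx.
Qed.

Lemma hform_emb_emb : hform h Xx Xx = 0.
Proof.
case: aF => XX YY XY _ _.
rewrite {2}/emb -scaleNr !hformDr hformZr hform_emb_frY.
rewrite /emb -scaleNr !hformDl !hformZl XX hform_frX hform_frY hform_mx -/(metric h F).
rewrite [hform h (_ *m _) X]hformC // hform_frX [hform h Y X]hformC // XY.
by set q := (_ *m _) 0 0; field.
Qed.

Lemma emb_cone : cone h Xx.
Proof.
split; last exact: hform_emb_emb.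
apply: contraTneq (oner_neq0 C) => e0.
by rewrite -hform_emb_frY e0 /hform !mul0mx mxE eqxx.
Qed.

Lemma metric_Zslot : Zx *m h *m Zx^T = g.
Proof.
apply/matrixP => a b; have := hform_Zslot (delta_mx 0 a) (delta_mx 0 b).
by rewrite hform_mx trmx_delta -!colE -!rowE ![col _ _ _ _]mxE ![row _ _ _ _]mxE.
Qed.

Lemma Zslot_free : row_free Zx.
Proof.
apply: inj_row_free => v vZ; rewrite -[v](mulmxK metric_unit) -metric_Zslot !mulmxA.
by rewrite vZ !mul0mx.
Qed.

Lemma emb_shift (v : 'rV[C]_n) (t : C) :
  emb h F (x + t *: v) =
  Xx + t *: (v *m Zx) - (2^-1 * t ^+ 2 * (v *m g *m v^T) 0 0) *: Y.
Proof.
rewrite mul_Zslot /emb mulmxDl -scalemxAl.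
have -> : ((x + t *: v) *m g *m (x + t *: v)^T) 0 0 =
    (x *m g *m x^T) 0 0 + 2 * t * (v *m g *m x^T) 0 0 + t ^+ 2 * (v *m g *m v^T) 0 0.
  rewrite -!hform_mx mulmxDl -scalemxAl hformDl !hformDr !hformZl !hformZr.
  rewrite (hformC h_sym (x *m Z) (v *m Z)).
  by move: (hform _ _ _) (hform _ _ _) (hform _ _ _) => a b c; ring.
set q := (x *m g *m x^T) 0 0; set r := (v *m g *m x^T) 0 0; set s := (_ *m v^T) 0 0.
move: q r s (x *m Z) (v *m Z) => q r s A B.
by apply/rowP => j; rewrite !mxE; field.
Qed.

(** The expansion of u in the moving frame X, Y, Z_a at the point x. *)
Lemma frame_expand u : u = hform h Y u *: Xx + hform h Xx u *: Y +
  (u *m h *m Zx^T *m invmx g) *m Zx.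
Proof.
case: (aF) => XX YY XY _ _.
set e := RHS; apply/eqP; rewrite -subr_eq0; apply/eqP.
have dl v : hform h (u - e) v = hform h u v - hform h e v.
  by rewrite -scaleN1r hformDl hformZl mulN1r.
have comb w : hform h e w = hform h Y u * hform h Xx w + hform h Xx u * hform h Y w +
    hform h ((u *m h *m Zx^T *m invmx g) *m Zx) w.
  by rewrite {1}/e 2!hformDl !hformZl.
clearbody e.
have EY : hform h (u - e) Y = 0.
  rewrite dl comb YY hform_emb_frY [hform h (_ *m Zx) Y]hformC //.
  by rewrite hform_frY_Zslot [hform h u Y]hformC // mulr1 mulr0 !addr0 subrr.
have EX : hform h (u - e) Xx = 0.
  rewrite dl comb hform_emb_emb [hform h (_ *m Zx) _]hformC //.
  rewrite hform_emb_Zslot [hform h Y Xx]hformC // hform_emb_frY [hform h u Xx]hformC //.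
  by rewrite mulr1 mulr0 add0r addr0 subrr.
have EZ v : hform h (u - e) (v *m Zx) = 0.
  rewrite dl comb hform_emb_Zslot hform_frY_Zslot hform_Zslot.
  rewrite mulmxKV ?metric_unit // !mulr0 !add0r -{1}[u]mul1mx hform_mx !mul1mx.
  by rewrite subrr.
have EZ0 v : hform h (u - e) (v *m Z) = 0.
  by have := EZ v; rewrite mul_Zslot -scaleNr hformDr hformZr EY mulr0 addr0.
apply: frame_span => //.
by move: EX; rewrite /emb -scaleNr !hformDr !hformZr EY EZ0 mulr0 !addr0.
Qed.

End Frame.

(** * Eigenspinors of a 2-form at a point *)
Section Eigenspinor.
Variables (R : realType) (n m : nat) (h : 'M[R[i]]_n.+2).
Variables (Gam : 'I_n.+2 -> 'M[R[i]]_(2 ^ m.+1)).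
Local Notation C := R[i].
Local Notation V := 'rV[C]_n.+2.
Local Notation N := (2 ^ m.+1)%N.
Local Notation sl := (slash Gam).
Hypotheses (h_sym : h^T = h) (h_nondeg : h \in unitmx).
Hypothesis hGam : clifford_module h Gam.
Variables (F : frame R n) (aF : adapted h F) (x : 'rV[C]_n).
Local Notation g := (metric h F).
Local Notation gi := (invmx (metric h F)).
Local Notation Xx := (emb h F x).
Local Notation Zx := (Zslot h F x).
Local Notation gam a := (gamma_tan h Gam F x a).
Local Notation tsl v := (sl (v *m Zx)).

Lemma tsl_sum v : tsl v = \sum_a v 0 a *: gam a.
Proof. exact: slash_sum. Qed.

Lemma gam_anticomm a v : gam a *m tsl v + tsl v *m gam a = (- 2 * (v *m g) 0 a)%:M.
Proof.
rewrite (slash_anticomm hGam); congr (_ * _)%:M.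
by rewrite rowE hform_Zslot // metric_swap // trmx_delta -colE mxE.
Qed.

(** The commutator of s^ab gamma_a gamma_b with a tangent vector v is the Clifford
    action of the vector 4 v g s. *)
Lemma quadratic_comm (s : 'M[C]_n) v : s^T = - s ->
  (\sum_a \sum_b s a b *: (gam a *m gam b)) *m tsl v =
  tsl v *m (\sum_a \sum_b s a b *: (gam a *m gam b)) + 4 *: tsl (v *m g *m s).
Proof.
move=> sskew; pose q := v *m g.
have mv a : gam a *m tsl v = (- 2 * q 0 a)%:M - tsl v *m gam a.
  by rewrite -gam_anticomm addrK.
have quad a b : gam a *m gam b *m tsl v =
    tsl v *m (gam a *m gam b) + (2 * q 0 a *: gam b - 2 * q 0 b *: gam a).
  rewrite -mulmxA mv mulmxBr (mulmxA (gam a)) mv mulmxBl mul_mx_scalar mul_scalar_mx.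
  by rewrite -mulmxA !mulNr !scaleNr opprB opprK addrC -addrA.
rewrite [X in _ = _ + X](_ : _ =
    \sum_a \sum_b s a b *: (2 * q 0 a *: gam b - 2 * q 0 b *: gam a)); last first.
  by rewrite tsl_sum; apply/esym; apply: skew_quadratic_comm.
rewrite mulmx_suml mulmx_sumr -big_split; apply: eq_bigr => a _ /=.
rewrite mulmx_suml mulmx_sumr -big_split; apply: eq_bigr => b _ /=.
by rewrite -scalemxAl quad scalerDr scalemxAr.
Qed.

Variables (sig : V -> 'M[C]_n.+2) (lam : C) (xi : 'cV[C]_N).
Local Notation sg := (sigma_chart h sig F x).
Local Notation K := (tan_ann_mx h Gam F x xi).
Local Notation Kperp := (kermx (g *m K^T)).

(** The row space of K is the totally null space N of the eigenspinor, and Kperp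
    is its orthogonal. *)
Lemma tan_annP (v : 'rV[C]_n) : (v <= K)%MS <-> tsl v *m xi = 0.
Proof. by rewrite tsl_sum; apply: ker_action. Qed.

Hypothesis sg_skew : sg^T = - sg.
Hypothesis eig : eigenspinor_at h Gam sig F x lam xi.

(** N is stable under sigma_a^b, by the commutator of the Clifford action of sigma
    with an element of N applied to xi. *)
Lemma tan_ann_stable (v : 'rV[C]_n) : (v <= K)%MS -> (v *m sg *m gi <= K)%MS.
Proof.
case: eig => _ _ eq /tan_annP vxi; apply/tan_annP.
have gu : g \in unitmx by apply: metric_unit.
have gis : gi^T = gi by rewrite trmx_inv metric_sym.
have sskew : (gi *m sg *m gi)^T = - (gi *m sg *m gi).
  exact: skew_conj.
have := quadratic_comm v sskew; rewrite -/(sigma_clifford h Gam sig F x).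
move/(congr1 (mulmx^~ xi)); rewrite mulmxDl -[LHS]mulmxA vxi mulmx0.
rewrite -(mulmxA (tsl v)) eq -scalemxAr vxi scaler0 add0r -scalemxAl => /esym/eqP.
rewrite scaler_eq0 pnatr_eq0 /= => /eqP.
by rewrite (mulmxK_solve v sg gi gu).
Qed.

Hypothesis pure : \rank K = m.
Variable eps : bool.
Hypothesis hn : n = (m.*2 + eps)%N.

Lemma tan_ann_isotropic (v w : 'rV[C]_n) : (v <= K)%MS -> (w <= K)%MS -> (v *m g *m w^T) 0 0 = 0.
Proof.
case: eig => _ xi0 _ /tan_annP vxi /tan_annP wxi; rewrite -(hform_Zslot h_sym aF x).
exact: (ann_isotropic hGam xi0).
Qed.

(** sigma pairs N to zero with its orthogonal, in which N has codimension eps <= 1. *)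
Lemma sigma_perp (v w : 'rV[C]_n) : (v <= Kperp)%MS -> (w <= Kperp)%MS -> (v *m sg *m w^T) 0 0 = 0.
Proof.
have gu : g \in unitmx by apply: metric_unit.
have le : (\rank Kperp <= (\rank K).+1)%N.
  have le : (n - m <= m.+1)%N.
    by rewrite hn leq_subLR -addnn addnS -addn1 leq_add2l; case: (eps).
  have e : \rank Kperp = (n - m)%N := etrans (rank_orth K gu) (congr1 (subn n) pure).
  by apply: leq_trans (eq_leq e) _; rewrite pure.
have sub : (K <= Kperp)%MS.
  by apply: orth_sub_orth; [exact: metric_sym | exact: tan_ann_isotropic].
move: v w; apply: (skew_form_vanish sg_skew sub le) => v w /tan_ann_stable vK /sub_orthP wK.
by have := wK _ vK; rewrite (metric_swap h_sym F) (mulmxKV gu).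
Qed.

(** The annihilator of xi in V contains X and the lift of N, which does not contain
    X; its dimension is also at most m + 1 since it is isotropic. *)
Lemma twistor_rank : \rank (ann_mx Gam xi) = m.+1.
Proof.
case: eig => Xxi xi0 _.
apply/eqP; rewrite eqn_leq (ann_rank_le h_sym h_nondeg hGam hn xi0) /=.
have rk : \rank (K *m Zx) = m by rewrite mxrankMfree // Zslot_free.
rewrite -[X in (X < _)%N]rk; apply: rank_ltmx; rewrite ltmxE; apply/andP; split.
  apply/row_subP => a; apply/annP; rewrite row_mul; apply/tan_annP.
  exact: row_sub.
apply/negP => /(submx_trans (proj2 (annP Gam xi Xx) Xxi)) /submxP[d XE].
have := hform_emb_frY h_sym aF x; rewrite XE mulmxA hformC // hform_frY_Zslot //.
by move/eqP; rewrite eq_sym oner_eq0.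
Qed.

(** Together with frame_expand: the orthogonal of the annihilator of xi in V is
    spanned by X and the lift of the orthogonal of N. *)
Lemma ann_perp_expand (u : V) : (forall y, sl y *m xi = 0 -> hform h u y = 0) ->
  hform h Xx u = 0 /\ (u *m h *m Zx^T *m gi <= Kperp)%MS.
Proof.
move=> H; split.
  by case: eig => Xxi _ _; rewrite hformC // H.
apply/sub_orthP => y /tan_annP yxi; rewrite mulmxKV ?metric_unit //.
by rewrite -(H _ yxi) /hform trmx_mul !mulmxA.
Qed.

End Eigenspinor.

(** * Contraction of the tractor 3-form *)
Section Trilinear.
Variables (R : realType) (k : nat).
Local Notation C := R[i].
Implicit Types (u v w : 'rV[C]_k) (T : 'I_k -> 'I_k -> 'I_k -> C).

(** The trilinear form with coefficients T, evaluated on three row vectors. *)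
Definition trilin T u v w : C :=
  \sum_a \sum_b \sum_c u 0 a * v 0 b * w 0 c * T a b c.

Lemma trilin_sum3 u v w T :
  trilin T u v w = \sum_(p : 'I_k * ('I_k * 'I_k))
    u 0 p.1 * v 0 p.2.1 * w 0 p.2.2 * T p.1 p.2.1 p.2.2.
Proof.
rewrite /trilin; under eq_bigr do rewrite pair_bigA /=.
by rewrite pair_bigA.
Qed.

Lemma trilinD T T' u v w :
  trilin (fun a b c => T a b c + T' a b c) u v w = trilin T u v w + trilin T' u v w.
Proof.
by rewrite !trilin_sum3 -big_split; apply: eq_bigr => p _; rewrite mulrDr.
Qed.

Lemma trilinZ x T u v w :
  trilin (fun a b c => x * T a b c) u v w = x * trilin T u v w.
Proof.
by rewrite !trilin_sum3 mulr_sumr; apply: eq_bigr => p _; rewrite mulrCA.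
Qed.

Lemma trilin_rot T u v w :
  trilin (fun a b c => T b c a) u v w = trilin T v w u.
Proof.
rewrite /trilin exchange_big; apply: eq_bigr => b _ /=.
rewrite exchange_big; apply: eq_bigr => c _ /=; apply: eq_bigr => a _.
by rewrite mulrC [RHS]mulrC; congr (_ * _); rewrite mulrC mulrA mulrC mulrA mulrAC.
Qed.

Lemma trilin_swap T u v w :
  trilin (fun a b c => T b a c) u v w = trilin T v u w.
Proof.
rewrite /trilin exchange_big; apply: eq_bigr => b _ /=; apply: eq_bigr => a _.
by apply: eq_bigr => c _; congr (_ * _ * _); rewrite mulrC.
Qed.

Lemma trilin_alt3 T u v w : trilin (fun a b c => alt3 T a b c) u v w =
  6^-1 * (trilin T u v w + trilin T v w u + trilin T w u v
          - trilin T v u w - trilin T u w v - trilin T w v u).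
Proof.
have e : (fun a b c => alt3 T a b c) = fun a b c => 6^-1 * (T a b c + T b c a + T c a b
    + -1 * T b a c + -1 * T a c b + -1 * T c b a).
  by do 3![apply/funext => ?]; rewrite /alt3 !mulN1r.
rewrite e trilinZ !trilinD !trilinZ !mulN1r.
pose S a b c := T b a c.
have e2 : trilin (fun a b c => T c a b) u v w = trilin T w u v.
  exact: etrans (trilin_rot (fun a b c => T b c a) u v w) (trilin_rot T v w u).
have e4 : trilin (fun a b c => T a c b) u v w = trilin T u w v.
  exact: etrans (trilin_rot (fun a b c => S b c a) u v w)
    (etrans (trilin_rot S v w u) (trilin_swap T w u v)).
have e5 : trilin (fun a b c => T c b a) u v w = trilin T w v u.
  exact: etrans (trilin_rot S u v w) (trilin_swap T v w u).
by rewrite (trilin_rot T) e2 (trilin_swap T) e4 e5.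
Qed.

Lemma trilin_alt3_eq0 x T u v w :
  (forall u' v' w', u' \in [:: u; v; w] -> v' \in [:: u; v; w] ->
     w' \in [:: u; v; w] -> trilin T u' v' w' = 0) ->
  trilin (fun a b c => x * alt3 T a b c) u v w = 0.
Proof.
move=> H; rewrite trilinZ trilin_alt3 !H ?inE ?eqxx ?orbT //.
by rewrite !(subr0, addr0, mulr0).
Qed.

Lemma trilin_factor (A : 'I_k -> C) (M : 'I_k -> 'I_k -> C) u v w :
  trilin (fun a b c => A a * M b c) u v w =
  (\sum_a u 0 a * A a) * (\sum_b \sum_c v 0 b * w 0 c * M b c).
Proof.
rewrite /trilin mulr_suml; apply: eq_bigr => a _; rewrite mulr_sumr.
apply: eq_bigr => b _; rewrite mulr_sumr; apply: eq_bigr => c _.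
by rewrite !mulrA; congr (_ * _); rewrite mulrAC; congr (_ * _); rewrite mulrAC.
Qed.

End Trilinear.

Section TractorContraction.
Variables (R : realType) (n : nat) (h : 'M[R[i]]_n.+2).
Local Notation C := R[i].
Local Notation V := 'rV[C]_n.+2.
Hypothesis h_sym : h^T = h.
Variables (sig : V -> 'M[C]_n.+2) (F : frame R n) (x : 'rV[C]_n).
Local Notation gi := (invmx (metric h F)).
Local Notation Zx := (Zslot h F x).
Local Notation proj u := (u *m h *m Zx^T *m gi).

Lemma Xlow_contract (u : V) : \sum_a u 0 a * Xlow h F x a = hform h (emb h F x) u.
Proof.
by rewrite /hform mxE; apply: eq_bigr => a _; rewrite /Xlow !mxE mulrC.
Qed.

Lemma Zlow_contract (u : V) b : \sum_a u 0 a * Zlow h F x b a = proj u 0 b.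
Proof.
have tr3 (p q : nat) (a : 'M[C]_p) (z : 'M[C]_(p, q)) (c : 'M[C]_q) :
    a^T = a -> c^T = c -> c *m z^T *m a = (a *m z *m c)^T.
  by move=> ea ec; rewrite !trmx_mul ea ec mulmxA.
have gis : gi^T = gi by rewrite trmx_inv metric_sym.
rewrite -mulmxA -mulmxA (mulmxA h) (tr3 _ _ gi Zx h) // mxE.
by apply: eq_bigr => a _; rewrite mxE.
Qed.

Lemma Zlow_contract2 (v w : V) (s : 'I_n -> 'I_n -> C) :
  \sum_b \sum_c v 0 b * w 0 c *
    (\sum_i \sum_j Zlow h F x i b * Zlow h F x j c * s i j) =
  \sum_i \sum_j proj v 0 i * proj w 0 j * s i j.
Proof.
under [RHS]eq_bigr do under eq_bigr do rewrite -!Zlow_contract.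
transitivity (\sum_b \sum_c \sum_i \sum_j
    v 0 b * Zlow h F x i b * (w 0 c * Zlow h F x j c) * s i j).
  do 2![apply: eq_bigr => ? _]; rewrite mulr_sumr; apply: eq_bigr => ? _.
  by rewrite mulr_sumr; apply: eq_bigr => ? _; rewrite mulrA mulrACA.
under [LHS]eq_bigr do rewrite exchange_big /=.
rewrite exchange_big; apply: eq_bigr => i _ /=.
under [LHS]eq_bigr do rewrite exchange_big /=.
rewrite exchange_big; apply: eq_bigr => j _ /=.
rewrite big_distrlr /= mulr_suml; apply: eq_bigr => b _.
by rewrite mulr_suml.
Qed.

Lemma trilin_mu (M : 'I_n -> 'I_n -> 'I_n -> C) (u v w : V) :
  trilin (fun a b c => \sum_i \sum_j \sum_k
    Zlow h F x i a * Zlow h F x j b * Zlow h F x k c * M i j k) u v w =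
  trilin M (proj u) (proj v) (proj w).
Proof.
rewrite /trilin.
transitivity (\sum_a u 0 a * \sum_i Zlow h F x i a *
   \sum_j \sum_k proj v 0 j * proj w 0 k * M i j k).
  apply: eq_bigr => a _; rewrite mulr_sumr.
  under [RHS]eq_bigr do rewrite -Zlow_contract2 mulrA mulr_sumr.
  rewrite [RHS]exchange_big; apply: eq_bigr => b _ /=.
  under [RHS]eq_bigr do rewrite mulr_sumr.
  rewrite [RHS]exchange_big; apply: eq_bigr => c _ /=.
  rewrite mulr_sumr; apply: eq_bigr => i _.
  rewrite !mulr_sumr; apply: eq_bigr => j _; rewrite !mulr_sumr.
  by apply: eq_bigr => k _; ring.
under eq_bigr do rewrite mulr_sumr.
rewrite exchange_big; apply: eq_bigr => i _ /=.
under eq_bigr do rewrite mulrA.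
rewrite -mulr_suml Zlow_contract mulr_sumr; apply: eq_bigr => j _.
by rewrite mulr_sumr; apply: eq_bigr => k _; rewrite !mulrA.
Qed.

(** On vectors orthogonal to X the last two terms of the tractor vanish, each having
    a factor X_A; the first two are sigma and mu on the tangential parts. *)
Lemma trilin_tractor3 (u v w : V) :
  (forall y, y \in [:: u; v; w] -> hform h (emb h F x) y = 0) ->
  (forall y z, y \in [:: u; v; w] -> z \in [:: u; v; w] ->
     (proj y *m sigma_chart h sig F x *m (proj z)^T) 0 0 = 0) ->
  trilin (mu h sig F x) (proj u) (proj v) (proj w) = 0 ->
  trilin (tractor3 h sig F x) u v w = 0.
Proof.
move=> HX Hs Hm.
pose T1 A B D := \sum_b \sum_c
  Ylow h F A * Zlow h F x b B * Zlow h F x c D * sigma_chart h sig F x b c.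
pose T2 A B D := \sum_a \sum_b \sum_c
  Zlow h F x a A * Zlow h F x b B * Zlow h F x c D * mu h sig F x a b c.
pose T3 A B D := \sum_c Xlow h F x A * Ylow h F B * Zlow h F x c D * phi h sig F x c.
pose T4 A B D := \sum_b \sum_c
  Xlow h F x A * Zlow h F x b B * Zlow h F x c D * rho h sig F x b c.
have e : tractor3 h sig F x =
    fun A B D => 3 * alt3 T1 A B D + T2 A B D + 6 * alt3 T3 A B D + 3 * alt3 T4 A B D.
  by [].
have Z1 u' v' w' : v' \in [:: u; v; w] -> w' \in [:: u; v; w] -> trilin T1 u' v' w' = 0.
  move=> v'i w'i.
  have -> : T1 = fun A B D => Ylow h F A * \sum_b \sum_c
      Zlow h F x b B * Zlow h F x c D * sigma_chart h sig F x b c.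
    apply/funext => A; apply/funext => B; apply/funext => D; rewrite /T1 mulr_sumr.
    by apply: eq_bigr => b _; rewrite mulr_sumr; apply: eq_bigr => c _; rewrite !mulrA.
  rewrite trilin_factor Zlow_contract2 [X in _ * X](_ : _ = 0) ?mulr0 //.
  rewrite -[RHS](Hs _ _ v'i w'i) mxE exchange_big; apply: eq_bigr => j _ /=.
  by rewrite [X in X * _]mxE [_^T _ _]mxE mulr_suml; apply: eq_bigr => i _; rewrite mulrAC.
have Z3 u' v' w' : u' \in [:: u; v; w] -> trilin T3 u' v' w' = 0.
  move=> u'i.
  have -> : T3 = fun A B D => Xlow h F x A * \sum_c
      Ylow h F B * Zlow h F x c D * phi h sig F x c.
    apply/funext => A; apply/funext => B; apply/funext => D; rewrite /T3 mulr_sumr.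
    by apply: eq_bigr => b _; rewrite !mulrA.
  by rewrite trilin_factor Xlow_contract HX // mul0r.
have Z4 u' v' w' : u' \in [:: u; v; w] -> trilin T4 u' v' w' = 0.
  move=> u'i.
  have -> : T4 = fun A B D => Xlow h F x A * \sum_b \sum_c
      Zlow h F x b B * Zlow h F x c D * rho h sig F x b c.
    apply/funext => A; apply/funext => B; apply/funext => D; rewrite /T4 mulr_sumr.
    by apply: eq_bigr => b _; rewrite mulr_sumr; apply: eq_bigr => c _; rewrite !mulrA.
  by rewrite trilin_factor Xlow_contract HX // mul0r.
rewrite e 3!trilinD trilin_mu Hm !trilin_alt3_eq0 ?addr0 //.
- by move=> u' v' w' ? _ _; apply: Z4.
- by move=> u' v' w' ? _ _; apply: Z3.
- by move=> u' v' w' _ ? ?; apply: Z1.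
Qed.

End TractorContraction.

(** * Complex differential calculus *)
Section HolomorphicCalculus.
Variables (R : realType).
Local Notation C := R[i].
Variable E : normedModType C.
Implicit Types (f : E -> C) (x v : E).

(** Complex differentiability at x of a scalar function. *)
Definition hol f x : Prop := differentiable (f : E -> C^o) x.

Lemma hol_cst (c : C) x : hol (fun=> c) x.
Proof. exact: differentiable_cst. Qed.

Lemma holD f1 f2 x : hol f1 x -> hol f2 x -> hol (fun y => f1 y + f2 y) x.
Proof. exact: differentiableD. Qed.

Lemma holM f1 f2 x : hol f1 x -> hol f2 x -> hol (fun y => f1 y * f2 y) x.
Proof. exact: differentiableM. Qed.

Lemma hol_sum (I : Type) (r : seq I) (P : pred I) (f : I -> E -> C) x :
  (forall i, hol (f i) x) -> hol (fun y => \sum_(i <- r | P i) f i y) x.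
Proof.
move=> H; elim: r => [|i r IH].
  rewrite (_ : (fun y => _) = fun=> 0); first exact: hol_cst.
  by apply/funext => y; rewrite big_nil.
case Pi : (P i).
  rewrite (_ : (fun y => _) = fun y => f i y + \sum_(j <- r | P j) f j y); first exact: holD.
  by apply/funext => y; rewrite big_cons Pi.
rewrite (_ : (fun y => _) = fun y => \sum_(j <- r | P j) f j y) //.
by apply/funext => y; rewrite big_cons Pi.
Qed.

Lemma hol_mx p q (M : E -> 'M[C]_(p, q)) x :
  (forall i j, hol (fun y => M y i j) x) -> differentiable M x.
Proof.
move=> H.
rewrite (_ : M = \sum_(i < p) \sum_(j < q) (fun y => M y i j *: (delta_mx i j : 'M[C]_(p, q)))).
  apply: differentiable_sum => i; apply: differentiable_sum => j.
  apply: (@differentiableZl C E ('M[C]_(p, q) : normedModType C) (fun y => M y i j)).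
  exact: H.
apply/funext => y; rewrite [LHS]matrix_sum_delta fct_sumE.
by apply: eq_bigr => i _; rewrite fct_sumE.
Qed.

Lemma holo_entry p q (M : E -> 'M[C]_(p, q)) x i j :
  differentiable M x -> hol (fun y => M y i j) x.
Proof.
move=> H; apply: (@differentiable_comp _ _ _ _ M (fun N : 'M[C]_(p, q) => N i j : C^o)) => //.
exact: differentiable_coord.
Qed.

Lemma hol_derivable f x v : hol f x -> derivable (f : _ -> C^o) x v.
Proof. exact: diff_derivable. Qed.

Lemma derive_entry p q (M : E -> 'M[C]_(p, q)) x v i j :
  differentiable M x -> ('D_v M x) i j = 'D_v (fun y => M y i j : C^o) x.
Proof.
move=> H; have dM : derivable M x v := diff_derivable H; apply/esym/cvg_lim => //.
have e t : t^-1 *: ((M (t *: v + x) i j : C^o) - M x i j) =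
    (t^-1 *: (M (t *: v + x) - M x)) i j by rewrite !mxE.
under eq_fun do rewrite e.
have := @coord_continuous _ _ _ i j ('D_v M x).
exact: (cvg_comp _ _ dM).
Qed.

Lemma derive_sumE p (f : 'I_p -> E -> C) x v : (forall i, hol (f i) x) ->
  'D_v (fun y => \sum_i f i y : C^o) x = \sum_i 'D_v (f i : _ -> C^o) x.
Proof.
move=> H; rewrite -(@derive_sum _ _ _ _ (fun i => f i : _ -> C^o)); last first.
  by move=> i; apply: hol_derivable.
by congr ('D_v _ x); apply/funext => y; rewrite fct_sumE.
Qed.

Lemma derive_mul f1 f2 x v : hol f1 x -> hol f2 x ->
  'D_v (fun y => f1 y * f2 y : C^o) x =
  'D_v (f1 : _ -> C^o) x * f2 x + f1 x * 'D_v (f2 : _ -> C^o) x.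
Proof.
move=> h1 h2.
have -> : 'D_v (fun y => f1 y * f2 y : C^o) x =
    f1 x *: 'D_v (f2 : _ -> C^o) x + f2 x *: 'D_v (f1 : _ -> C^o) x.
  exact: (@deriveM _ _ (f1 : _ -> C^o) (f2 : _ -> C^o) x v
    (hol_derivable h1) (hol_derivable h2)).
move: ('D_v _ x) ('D_v _ x) => a b.
by rewrite addrC; congr (_ + _); apply: mulrC.
Qed.

Lemma derive_bilinear n (u w : 'I_n -> E -> C) (s : 'I_n -> 'I_n -> E -> C) x v :
  (forall a, hol (u a) x) -> (forall a, hol (w a) x) -> (forall a b, hol (s a b) x) ->
  'D_v (fun y => \sum_a \sum_b u a y * s a b y * w b y : C^o) x =
  \sum_a \sum_b ('D_v (u a : _ -> C^o) x * s a b x * w b x +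
    u a x * 'D_v (s a b : _ -> C^o) x * w b x +
    u a x * s a b x * 'D_v (w b : _ -> C^o) x).
Proof.
move=> hu hw hs.
have husw a b : hol (fun y => u a y * s a b y * w b y) x.
  exact: (holM (holM (hu a) (hs a b)) (hw b)).
rewrite derive_sumE; last by move=> a; apply: hol_sum; exact: husw.
apply: eq_bigr => a _; rewrite derive_sumE; last exact: husw.
apply: eq_bigr => b _.
rewrite (derive_mul _ (holM (hu a) (hs a b)) (hw b)) (derive_mul _ (hu a) (hs a b)).
by rewrite mulrDl.
Qed.

End HolomorphicCalculus.

Lemma hol_coord (R : realType) k i j (x : 'rV[R[i]]_k) : hol (fun y : 'rV[R[i]]_k => y i j) x.
Proof. exact: differentiable_coord. Qed.

Lemma derive_dir (R : realType) k (f : 'rV[R[i]]_k -> R[i]) (x v : 'rV[R[i]]_k) : hol f x ->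
  'D_v (f : _ -> R[i]^o) x = \sum_c v 0 c * pd c (f : _ -> R[i]^o) x.
Proof.
move=> H; rewrite deriveE // [v in LHS]row_sum_delta linear_sum.
by apply: eq_bigr => c _; rewrite linearZ /pd deriveE.
Qed.

(** * Integrability and the exterior derivative of sigma *)
Section ChartHolomorphy.
Variables (R : realType) (n : nat) (h : 'M[R[i]]_n.+2).
Local Notation C := R[i].
Local Notation V := 'rV[C]_n.+2.
Variable F : frame R n.
Local Notation g := (metric h F).

Lemma hol_Zslot a j x : hol (fun y => Zslot h F y a j) x.
Proof.
rewrite (_ : (fun y => _) = fun y : 'rV[C]_n => frZ F a j + (- frY F 0 j) * \sum_b y 0 b * g b a).
  apply: holD; first exact: hol_cst.
  apply: holM; first exact: hol_cst.
  by apply: hol_sum => b; apply: holM; [exact: hol_coord | exact: hol_cst].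
apply/funext => y; rewrite /Zslot mxE; congr (_ + _).
by rewrite mxE mulNr [LHS]/= mxE big_ord1 mxE mulrC; congr (- (_ * _)); rewrite mxE.
Qed.

Lemma hol_emb j x : hol (fun y => emb h F y 0 j) x.
Proof.
rewrite (_ : (fun y => _) = fun y : 'rV[C]_n => frX F 0 j + \sum_a y 0 a * frZ F a j +
   - (2^-1 * frY F 0 j) * \sum_b (\sum_a y 0 a * g a b) * y 0 b).
  apply: holD.
    apply: holD; first exact: hol_cst.
    by apply: hol_sum => b; apply: holM; [exact: hol_coord | exact: hol_cst].
  apply: holM; first exact: hol_cst.
  apply: hol_sum => b; apply: holM; last exact: hol_coord.
  by apply: hol_sum => a; apply: holM; [exact: hol_coord | exact: hol_cst].
apply/funext => y.
rewrite /emb mxE [X in X + _ = _]mxE [X in _ + X + _ = _]mxE; congr (_ + _).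
rewrite mxE mxE mulNr mulrAC; congr (- (_ * _ * _)).
by rewrite mxE; apply: eq_bigr => b _; rewrite mxE [in RHS]/= mxE.
Qed.

Lemma holo_emb x : holo_at (emb h F) x.
Proof. by apply: hol_mx => i j; rewrite ord1; apply: hol_emb. Qed.

Lemma copen_chart_dom (U : set V) : h^T = h -> adapted h F ->
  open_in_quadric h U -> copen (chart_dom h U F).
Proof.
move=> h_sym aF [_ _ [W Wo UE]].
rewrite (_ : chart_dom h U F = emb h F @^-1` W).
  apply: (@open_comp ('rV[C]_n : normedModType C) ('rV[C]_n.+2 : normedModType C)) => // x _.
  exact: (differentiable_continuous (holo_emb x)).
apply/seteqP; split => x; rewrite /chart_dom /= UE; first by case.
by move=> Wx; split=> //; apply: emb_cone.
Qed.

End ChartHolomorphy.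

Section PerpSections.
Variables (R : realType) (n m : nat) (h : 'M[R[i]]_n.+2).
Variables (Gam : 'I_n.+2 -> 'M[R[i]]_(2 ^ m.+1)).
Local Notation C := R[i].
Local Notation V := 'rV[C]_n.+2.
Local Notation N := (2 ^ m.+1)%N.
Hypotheses (h_sym : h^T = h) (h_nondeg : h \in unitmx).
Variables (F : frame R n) (aF : adapted h F).
Local Notation g := (metric h F).
Local Notation gi := (invmx (metric h F)).
Variable xi : V -> 'cV[C]_N.
Local Notation ann_rows y :=
  (\matrix_(a < n) (gamma_tan h Gam F y a *m xi (emb h F y))^T).
Local Notation perp y := (Defs.orthogonal g (null_dist h Gam xi F y)).

(** Holomorphic sections of the orthogonal of N, indexed by constant spinors c. The
    space N_y is the left kernel of the matrix with rows gamma_a xi, so its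
    orthogonal is g^-1 applied to the column space; no local constancy of the rank
    is needed, and every orthogonal vector extends to such a section. *)
Definition perp_section (c : 'cV[C]_N) (y : 'rV[C]_n) : 'rV[C]_n :=
  (gi *m ann_rows y *m c)^T.

Lemma perpP y w : perp y w <-> (w <= kermx (g *m (tan_ann_mx h Gam F y (xi (emb h F y)))^T))%MS.
Proof.
split=> [H|/sub_orthP H v Hv].
  by apply/sub_orthP => v /ker_action Hv; rewrite metric_swap //; apply: H.
by rewrite metric_swap //; apply: H; apply/ker_action.
Qed.

Lemma perp_section_perp c y : perp y (perp_section c y).
Proof.
have gu : g \in unitmx by apply: metric_unit.
move=> v /ker_action/sub_kermxP Hv; rewrite /perp_section trmxK.
by rewrite mulmxK_solve // Hv mul0mx mxE.
Qed.

Lemma perp_section_surj y w : perp y w -> exists c, w = perp_section c y.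
Proof.
have gu : g \in unitmx by apply: metric_unit.
move=> H; have : kermx (ann_rows y) *m (g *m w^T) = 0.
  apply/row_matrixP => i; rewrite row_mul mulmxA row0; apply/rowP => j.
  rewrite ord1 [RHS]mxE; apply: H; apply/ker_action; exact: row_sub.
case/ker_col_factor => c e; exists c; rewrite /perp_section -mulmxA -e.
by rewrite mulKmx // trmxK.
Qed.

Lemma hol_ann_rows y a i : (forall j, hol (fun z => xi (emb h F z) j 0) y) ->
  hol (fun z => (ann_rows z) a i) y.
Proof.
move=> Hxi.
rewrite (_ : (fun z => _) = fun z : 'rV[C]_n =>
    \sum_k (\sum_A Zslot h F z a A * Gam A i k) * xi (emb h F z) k 0).
  apply: hol_sum => k; apply: holM; last exact: Hxi.
  by apply: hol_sum => A; apply: holM; [exact: hol_Zslot | exact: hol_cst].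
apply/funext => z; rewrite mxE mxE mxE; apply: eq_bigr => k _; congr (_ * _).
rewrite /gamma_tan /slash summxE; apply: eq_bigr => A _.
by rewrite mxE mxE.
Qed.

Lemma holo_perp_section c y : (forall j, hol (fun z => xi (emb h F z) j 0) y) ->
  holo_at (perp_section c) y.
Proof.
move=> Hxi; apply: hol_mx => i j.
rewrite (_ : (fun z => _) = fun z : 'rV[C]_n => \sum_k (\sum_b gi j b * (ann_rows z) b k) * c k 0).
  apply: hol_sum => k; apply: holM; last exact: hol_cst.
  apply: hol_sum => b; apply: holM; first exact: hol_cst.
  exact: hol_ann_rows.
apply/funext => z; rewrite ord1 mxE mxE; apply: eq_bigr => k _; congr (_ * _).
by rewrite mxE.
Qed.

Variables (U : set V) (sig : V -> 'M[C]_n.+2).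
Local Notation Om := (chart_dom h U F).
Local Notation sg := (sigma_chart h sig F).
Hypothesis openOm : copen Om.
Hypothesis xi_hol : forall y, Om y -> forall j, hol (fun z => xi (emb h F z) j 0) y.
Hypothesis sg_hol : forall y, Om y -> forall a b, hol (fun z => sg z a b) y.
Hypothesis sg_skew : forall y, Om y -> (sg y)^T = - sg y.
Hypothesis sg_perp : forall y u w, Om y -> perp y u -> perp y w ->
  (u *m sg y *m w^T) 0 0 = 0.
Hypothesis coint : Defs.involutive Om (fun y => perp y).

Lemma form_sum y (u w : 'rV[C]_n) :
  (u *m sg y *m w^T) 0 0 = \sum_a \sum_b u 0 a * sg y a b * w 0 b.
Proof.
rewrite mxE exchange_big; apply: eq_bigr => b _ /=.
by rewrite mxE mulr_suml; apply: eq_bigr => a _; rewrite [w^T _ _]mxE.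
Qed.

(** The derivative of sigma(u, w) = 0 along v, for u and w sections of the
    orthogonal of N. *)
Lemma dsigma_Leibniz x0 (u w : 'rV[C]_n -> 'rV[C]_n) (v : 'rV[C]_n) : Om x0 ->
  (forall y, Om y -> [/\ holo_at u y, holo_at w y, perp y (u y) & perp y (w y)]) ->
  trilin (dsigma h sig F x0) v (u x0) (w x0) =
  - ('D_v u x0 *m sg x0 *m (w x0)^T) 0 0 - (u x0 *m sg x0 *m ('D_v w x0)^T) 0 0.
Proof.
move=> Ox0 H; have [hu hw _ _] := H _ Ox0.
have hua a : hol (fun y => u y 0 a) x0 by apply: holo_entry.
have hwa a : hol (fun y => w y 0 a) x0 by apply: holo_entry.
have L0 : 'D_v (fun y => \sum_a \sum_b u y 0 a * sg y a b * w y 0 b : C^o) x0 = 0.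
  rewrite (@near_eq_derive _ _ _ _ (fun=> 0 : C^o)) ?derive_cst //.
  have := open_nbhs_nbhs (conj openOm Ox0); apply: filterS => y Oy.
  by have [_ _ pu pw] := H _ Oy; rewrite -form_sum sg_perp.
move: L0; rewrite (derive_bilinear v hua hwa (sg_hol Ox0)).
have -> : \sum_a \sum_b ('D_v (fun y => u y 0 a : C^o) x0 * sg x0 a b * w x0 0 b +
    u x0 0 a * 'D_v (fun y => sg y a b : C^o) x0 * w x0 0 b +
    u x0 0 a * sg x0 a b * 'D_v (fun y => w y 0 b : C^o) x0) =
  ('D_v u x0 *m sg x0 *m (w x0)^T) 0 0 + trilin (dsigma h sig F x0) v (u x0) (w x0) +
  (u x0 *m sg x0 *m ('D_v w x0)^T) 0 0.
  rewrite !form_sum.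
  have -> : trilin (dsigma h sig F x0) v (u x0) (w x0) =
      \sum_a \sum_b u x0 0 a * 'D_v (fun y => sg y a b : C^o) x0 * w x0 0 b.
    rewrite /trilin exchange_big; apply: eq_bigr => a _ /=.
    rewrite exchange_big; apply: eq_bigr => b _ /=.
    rewrite derive_dir; last exact: sg_hol.
    rewrite mulr_sumr mulr_suml; apply: eq_bigr => c _; rewrite /dsigma; ring.
  rewrite -!big_split; apply: eq_bigr => a _; rewrite -!big_split.
  apply: eq_bigr => b _ /=.
  exact: (f_equal2 (fun s t : C => s * sg x0 a b * w x0 0 b +
    u x0 0 a * 'D_v (fun y => sg y a b : C^o) x0 * w x0 0 b +
    u x0 0 a * sg x0 a b * t)
    (esym (derive_entry v 0 a hu)) (esym (derive_entry v 0 b hw))).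
by move/eqP; rewrite addrAC addr_eq0 => /eqP e; rewrite -opprD e opprK.
Qed.

(** This is d sigma on the orthogonal of N: differentiating sigma(u, v) = 0 for
    sections of the distribution leaves only values of sigma on Lie brackets, which
    vanish by involutivity. *)
Lemma dsigma_cyclic x0 u v w : Om x0 -> perp x0 u -> perp x0 v -> perp x0 w ->
  trilin (dsigma h sig F x0) u v w + trilin (dsigma h sig F x0) v w u +
  trilin (dsigma h sig F x0) w u v = 0.
Proof.
move=> Ox0 /perp_section_surj[cu ->] /perp_section_surj[cv ->] /perp_section_surj[cw ->].
pose s := perp_section.
have sec c : forall y, Om y -> holo_at (s c) y /\ perp y (s c y).
  by move=> y Oy; split; [apply: holo_perp_section; exact: xi_hol | exact: perp_section_perp].
have sec2 c d : forall y, Om y ->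
    [/\ holo_at (s c) y, holo_at (s d) y, perp y (s c y) & perp y (s d y)].
  by move=> y Oy; have [? ?] := sec c y Oy; have [? ?] := sec d y Oy.
have skew (y z : 'rV[C]_n) : (y *m sg x0 *m z^T) 0 0 = - (z *m sg x0 *m y^T) 0 0.
  have /matrixP sk := sg_skew Ox0.
  rewrite !form_sum exchange_big -sumrN; apply: eq_bigr => a _ /=.
  rewrite -sumrN; apply: eq_bigr => b _; have := sk a b; rewrite !mxE => ->.
  by rewrite mulrN mulNr; congr (- _); ring.
have formB (y z : 'rV[C]_n) (M : 'M[C]_n) (t : 'cV[C]_n) :
    ((y - z) *m M *m t) 0 0 = (y *m M *m t) 0 0 - (z *m M *m t) 0 0.
  by rewrite mulmxBl mulmxBl mxE [X in _ + X]mxE.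
(* A c d e is sigma (D_c d, e); involutivity is the symmetry of A in c and d. *)
have [A [AL AB]] : exists A : 'cV[C]_N -> 'cV[C]_N -> 'cV[C]_N -> C,
    (forall c d e, trilin (dsigma h sig F x0) (s c x0) (s d x0) (s e x0) =
       - A c d e + A c e d) /\
    (forall c d e, A c d e = A d c e).
  exists (fun c d e => ('D_(s c x0) (s d) x0 *m sg x0 *m (s e x0)^T) 0 0).
  split=> c d e.
    rewrite (dsigma_Leibniz _ Ox0 (sec2 _ _)); congr (_ + _).
    by apply/eqP; rewrite eqr_oppLR; apply/eqP; apply: skew.
  apply/eqP; rewrite -subr_eq0 -formB; apply/eqP; apply: sg_perp => //.
    exact: (coint openOm (fun y Oy => Oy) (sec2 c d) Ox0).
  exact: (sec e x0 Ox0).2.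
rewrite -/(s cu x0) -/(s cv x0) -/(s cw x0) !AL.
by rewrite (AB cv cu) (AB cw cv) (AB cu cw); ring.
Qed.

Lemma mu_perp x0 u v w : Om x0 -> perp x0 u -> perp x0 v -> perp x0 w ->
  trilin (mu h sig F x0) u v w = 0.
Proof.
move=> Ox0 pu pv pw; rewrite -[LHS]/(trilin (fun a b c => alt3 (dsigma h sig F x0) a b c) u v w).
rewrite trilin_alt3 (dsigma_cyclic Ox0 pu pv pw) add0r.
have := dsigma_cyclic Ox0 pv pu pw.
move: (trilin _ v u w) (trilin _ u w v) (trilin _ w v u) => a b c e.
have -> : - a - b - c = - (a + b + c) by ring.
by rewrite e oppr0 mulr0.
Qed.

End PerpSections.

(** * The tangent space of the linear subspace of a twistor *)
Section TangentSpace.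
Variables (R : realType) (n m : nat) (h : 'M[R[i]]_n.+2).
Variables (Gam : 'I_n.+2 -> 'M[R[i]]_(2 ^ m.+1)).
Local Notation C := R[i].
Local Notation V := 'rV[C]_n.+2.
Local Notation N := (2 ^ m.+1)%N.
Local Notation sl := (slash Gam).
Hypotheses (h_sym : h^T = h) (h_nondeg : h \in unitmx).
Hypothesis hGam : clifford_module h Gam.
Variables (F : frame R n) (aF : adapted h F) (x : 'rV[C]_n).
Local Notation g := (metric h F).
Local Notation Zx := (Zslot h F x).
Variable Z : 'cV[C]_N.
Hypotheses (Z0 : Z != 0) (xZ : sl (emb h F x) *m Z = 0).

Lemma is_derive_line (v : 'rV[C]_n) (t : C^o) :
  is_derive t (1 : C^o) (fun s : C^o => x + (s : C) *: v) v.
Proof.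
pose f (s : C^o) : 'rV[C]_n := (s : C) *: v.
have [df dfE] : is_diff (t : C^o) f f by exact: is_diff_scalel.
have ft : is_derive t (1 : C^o) f v.
  by apply: DeriveDef; [exact: diff_derivable | rewrite deriveE // dfE /f scale1r].
have := is_deriveD (is_derive_cst x t (1 : C^o)) ft.
by rewrite add0r.
Qed.

(** The linear subspace of Z contains the image of the whole line x + t v, since v is
    null. *)
Lemma zcheck_line (v : 'rV[C]_n) (t : C) : sl (v *m Zx) *m Z = 0 ->
  zcheck h Gam Z (emb h F (x + t *: v)).
Proof.
move=> vZ; split; first exact: emb_cone.
have q0 : (v *m g *m v^T) 0 0 = 0.
  by rewrite -(hform_Zslot h_sym aF x); exact: (ann_isotropic hGam Z0 vZ vZ).
have := emb_shift h_sym F x v t.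
rewrite q0.
rewrite mulr0 scale0r subr0 => ->.
rewrite slashD slashZ mulmxDl xZ -scalemxAl vZ.
by rewrite scaler0 addr0.
Qed.

(** emb (x + d) differs from its linearisation by a multiple of g(d, d), whose
    derivative along the curve vanishes at the point x. *)
Lemma zcheck_tangent (c : C^o -> 'rV[C]_n) (v : 'rV[C]_n) :
  c 0 = x -> is_derive (0 : C^o) (1 : C^o) c v ->
  (\forall t \near (0 : C^o), sl (emb h F (c t)) *m Z = 0) ->
  sl (v *m Zx) *m Z = 0.
Proof.
move=> c0 [dc dcv] near0; apply/matrixP => i j; rewrite ord1 {j} [RHS]mxE.
have cdiff : differentiable c (0 : C^o) by apply/derivable1_diffP.
pose e a (t : C^o) : C := c t 0 a - x 0 a.
have he a : hol (e a) (0 : C^o).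
  by apply: holD; [apply: holo_entry | apply: hol_cst].
have e0 a : e a 0 = 0 by rewrite /e c0 subrr.
have de a : 'D_1 (e a : C^o -> C^o) (0 : C^o) = v 0 a.
  rewrite -dcv (derive_entry _ _ _ cdiff).
  rewrite deriveB; [|exact: (hol_derivable (holo_entry 0 a cdiff)) | exact: derivable_cst].
  by rewrite derive_cst subr0.
pose K a := (sl (row a Zx) *m Z) i 0.
pose q := 2^-1 * (sl (frY F) *m Z) i 0.
have E t : sl (emb h F (c t)) *m Z = 0 ->
    \sum_a e a t * K a = \sum_a \sum_b e a t * (g a b * q) * e b t.
  pose d : 'rV[C]_n := c t - x.
  have da a : d 0 a = e a t by rewrite /d /e !mxE.
  pose r := (d *m g *m d^T) 0 0.
  have key : sl (emb h F (c t)) *m Z =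
      sl (d *m Zx) *m Z - (2^-1 * r) *: (sl (frY F) *m Z).
    have -> : c t = x + 1 *: d by rewrite scale1r addrC subrK.
    rewrite (emb_shift h_sym F x d 1) scale1r expr1n mulr1 -/r -scaleNr.
    rewrite slashD slashD slashZ mulmxDl mulmxDl xZ add0r.
    by rewrite -scalemxAl scaleNr.
  rewrite key => /eqP; rewrite subr_eq0 => /eqP e1.
  have e2 : (sl (d *m Zx) *m Z) i 0 = \sum_a e a t * K a.
    rewrite slash_sum mulmx_suml summxE; apply: eq_bigr => a _.
    by rewrite -scalemxAl mxE da.
  rewrite -e2 e1 mxE.
  have -> : r = \sum_a \sum_b e a t * g a b * e b t.
    rewrite /r mxE exchange_big; apply: eq_bigr => b _ /=.
    rewrite [d^T _ _]mxE da mxE mulr_suml; apply: eq_bigr => a _.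
    by rewrite da.
  rewrite mulr_sumr mulr_suml; apply: eq_bigr => a _.
  rewrite mulr_sumr mulr_suml; apply: eq_bigr => b _.
  by rewrite /q; ring.
have D1 : 'D_1 (fun t : C^o => \sum_a e a t * K a : C^o) (0 : C^o) = (sl (v *m Zx) *m Z) i 0.
  rewrite derive_sumE; last by move=> a; apply: holM; [exact: he | exact: hol_cst].
  rewrite slash_sum mulmx_suml summxE; apply: eq_bigr => a _.
  rewrite (derive_mul _ (he a) (hol_cst _ _)) derive_cst mulr0 addr0 de.
  by rewrite -scalemxAl mxE.
rewrite -D1.
rewrite (@near_eq_derive _ _ _ _ (fun t => \sum_a \sum_b e a t * (g a b * q) * e b t : C^o)).
  rewrite (@derive_bilinear _ _ _ e e (fun a b => fun=> g a b * q) _ _ he he); last first.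
    by move=> a b; apply: hol_cst.
  apply: big1 => a _; apply: big1 => b _.
  by rewrite derive_cst !e0 !(mul0r, mulr0, addr0).
near=> t; apply: E; near: t; exact: near0.
Unshelve. all: by end_near. Qed.

End TangentSpace.

Theorem proposition4p7 (R : realType) (m n : nat) (eps : bool)
    (hn : n = (m.*2 + eps)%N) (hn3 : (3 <= n)%N)
    (h : 'M[R[i]]_n.+2) (h_sym : h^T = h) (h_nondeg : h \in unitmx)
    (Gam : 'I_n.+2 -> 'M[R[i]]_(2 ^ m.+1)) (hGam : clifford_module h Gam)
    (chi : 'M[R[i]]_(2 ^ m.+1)) (hchi : ~~ eps -> chirality Gam chi)
    (B : 'M[R[i]]_(2 ^ m.+1)) (hB : spin_invariant_pairing h Gam B)
    (U : set 'rV[R[i]]_n.+2) (hU : open_in_quadric h U)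
    (sig : 'rV[R[i]]_n.+2 -> 'M[R[i]]_n.+2) (hsig : cky h U sig)
    (hgen : generic h Gam sig U eps chi)
    (Sigma : 'I_n.+2 -> 'I_n.+2 -> 'I_n.+2 -> R[i])
    (hSigma : associated_tractor h U sig Sigma)
    (xi : 'rV[R[i]]_n.+2 -> 'cV[R[i]]_(2 ^ m.+1))
    (hxi : eigenspinor_field h Gam sig U eps chi xi)
    (hint : integrable_null h Gam U xi)
    (hcoint : cointegrable_null h Gam U xi) :
  arises_from h Gam U xi (tractor_submanifold h Gam eps chi B U Sigma).
Proof.
move=> F aF x0 Ux0.
have [[w [xi_nz _ xi_holo]] xi_S xi_eig] := hxi.
have [[sig_skew _ _ sig_holo] _] := hsig.
have Om_open : copen (chart_dom h U F) by apply: copen_chart_dom.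
have xi_hol y : chart_dom h U F y -> forall j, hol (fun z => xi (emb h F z) j 0) y.
  by move=> Uy j; apply: xi_holo.
have sg_hol y : chart_dom h U F y ->
    forall a b, hol (fun z => sigma_chart h sig F z a b) y.
  by move=> Uy a b; apply: sig_holo.
have sg_skew y : chart_dom h U F y ->
    (sigma_chart h sig F y)^T = - sigma_chart h sig F y.
  move=> Uy.
  have E a b : sigma_chart h sig F y a b =
      weighted_form sig (emb h F y) (row a (Zslot h F y)) (row b (Zslot h F y)).
    by rewrite /weighted_form /sigma_chart tr_row -row_mul -row_mul colE mulmxA -colE !mxE.
  have orth a : hform h (emb h F y) (row a (Zslot h F y)) = 0.
    by rewrite rowE hform_emb_Zslot.
  by apply/matrixP => a b; rewrite mxE [RHS]mxE !E; apply: sig_skew.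
have eig y : chart_dom h U F y -> exists lam,
    eigenspinor_at h Gam sig F y lam (xi (emb h F y)) /\
    \rank (tan_ann_mx h Gam F y (xi (emb h F y))) = m.
  move=> Uy; have [lam e] := xi_eig F aF y Uy; exists lam; split=> //.
  by have [_ _ _ _ pure] := hgen F aF y Uy; apply: pure e.
have sg_perp y u v : chart_dom h U F y ->
    Defs.orthogonal (metric h F) (null_dist h Gam xi F y) u ->
    Defs.orthogonal (metric h F) (null_dist h Gam xi F y) v ->
    (u *m sigma_chart h sig F y *m v^T) 0 0 = 0.
  move=> Uy /(perpP Gam h_sym) pu /(perpP Gam h_sym) pv; have [lam [e pure]] := eig y Uy.
  exact: (sigma_perp h_sym h_nondeg hGam aF (sg_skew y Uy) e pure hn pu pv).
exists (chart_dom h U F), (fun x => xi (emb h F x)); split=> //.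
  by move=> x Ux; apply: hol_mx => i j; rewrite ord1; apply: xi_hol.
move=> x Ux; set Z := xi (emb h F x).
have [lam [e pure]] := eig x Ux.
have [XZ Z0 _] := e.
have XcZ : zcheck h Gam Z (emb h F x) by split; [exact: emb_cone|].
split=> //.
  split; last first.
  - move=> s _.
    apply: (@raised_contraction _ _ _ h Gam h_nondeg Sigma
      (fun a b c => gamma_form Gam B [:: a, b, c & s] Z Z) Z).
      by move=> y yZ; exact: (gamma_form_ann h_sym h_nondeg hGam hB s yZ).
    move=> u1 u2 u3 H1 H2 H3.
    have SE : Sigma = tractor3 h sig F x.
      by apply/funext => a; apply/funext => b; apply/funext => c; apply: hSigma.2.
    have [X1 P1] := ann_perp_expand h_sym h_nondeg aF e H1.
    have [X2 P2] := ann_perp_expand h_sym h_nondeg aF e H2.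
    have [X3 P3] := ann_perp_expand h_sym h_nondeg aF e H3.
    rewrite SE; apply: trilin_tractor3 => //.
    + by move=> y; rewrite !inE => /or3P[] /eqP ->.
    + have P y : y \in [:: u1; u2; u3] -> Defs.orthogonal (metric h F)
          (null_dist h Gam xi F x) (y *m h *m (Zslot h F x)^T *m invmx (metric h F)).
        by rewrite !inE => /or3P[] /eqP ->; apply/(perpP Gam h_sym).
      by move=> y z /P py /P pz; apply: sg_perp.
    + apply: (@mu_perp _ _ _ h Gam h_sym h_nondeg F aF xi U sig) => //.
      * exact: (hcoint F aF).
      * exact/(perpP Gam h_sym).
      * exact/(perpP Gam h_sym).
      * exact/(perpP Gam h_sym).
  - by exists (emb h F x).
  - split=> //; first exact: xi_S.
    exact: (twistor_rank h_sym h_nondeg hGam aF e pure hn).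
apply/seteqP; split=> v.
  rewrite /null_dist /= -slash_sum => vZ.
  exists (fun t : (R[i])^o => x + (t : R[i]) *: v); split.
  - by rewrite scale0r addr0.
  - exact: is_derive_line.
  - apply: filterE => t; split; last exact: zcheck_line.
    by have [] := is_derive_line x v t.
case=> c [c0 dc near0]; rewrite /null_dist /= -slash_sum.
apply: (zcheck_tangent h_sym XZ c0 dc).
by apply: filterS near0 => t [_ []].
Qed.
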